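(* Suppose that Assumption 1 and Assumption 2 hold, and let $\alpha\in(0,1]$ be as in Assumption 2. Let $\theta_0\in\mathbb{R}^d$, $\beta\in(0,1)$ and let $n:\mathbb{N}\to\mathbb{N}$ be such that $$0<\liminf_{B\to\infty}\frac{n(B)}{B^{\frac{1+\alpha}{1+3\alpha}}}\le\limsup_{B\to\infty}\frac{n(B)}{B^{\frac{1+\alpha}{1+3\alpha}}}<\infty.$$ For every $B\in\mathbb{N}$ let $(\tilde\theta_B,\tilde B)=\mathrm{GD}\big(\theta_0,n(B),B,0,\beta\big)$, with the procedure $\mathrm{GD}$ defined in the context. Then, as $B\to\infty$, $$\|\tilde\theta_B-\theta_\star\|=O_{\mathbb{P}}\big(n(B)^{-\frac{\alpha}{1+\alpha}}\big)=O_{\mathbb{P}}\big(B^{-\frac{\alpha}{1+3\alpha}}\big).$$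
   Context: Setting. $\mathbb{N}=\{1,2,\dots\}$, $d\ge1$. All random variables are defined on a complete probability space $(\Omega,\mathcal{F},\mathbb{P})$. $Z$ is a random variable with values in a Polish space $\mathsf{Z}$, and $(Z_i)_{i\ge1}$ are i.i.d. copies of $Z$. The function $f:\mathbb{R}^d\times\mathsf{Z}\to\mathbb{R}$ is measurable and differentiable in its first argument; $\nabla^k f(\theta,z)$ denotes the $k$-th derivative in $\theta$ ($\nabla^0f=f$). $F(\theta)=\mathbb{E}[f(\theta,Z)]$ is finite for all $\theta$, strictly convex on $\mathbb{R}^d$, and has a (unique) minimizer $\theta_\star=\arg\min_{\theta\in\mathbb{R}^d}F(\theta)$. For $n\in\mathbb{N}$, $F_n(\theta)=\frac1n\sum_{i=1}^n f(\theta,Z_i)$. $\|\cdot\|$ is the Euclidean norm for vectors and the induced operator norm for matrices. No convexity of $\theta\mapsto f(\theta,Z)$ is assumed. Assumption 1. For every compact set $\Theta\subset\mathbb{R}^d$ there is a constant $c_\Theta>0$ such that $F(a\theta_1+(1-a)\theta_2)\le aF(\theta_1)+(1-a)F(\theta_2)-\frac{c_\Theta}{2}a(1-a)\|\theta_1-\theta_2\|^2$ for all $a\in[0,1]$ and $(\theta_1,\theta_2)\in\Theta^2$. Assumption 2. The map $\theta\mapsto f(\theta,z)$ is twice continuously differentiable on $\mathbb{R}^d$ for all $z\in\mathsf{Z}$; $\mathbb{E}[\|\nabla^2 f(\theta_\star,Z)\|]<\infty$ and $\mathbb{E}[\|\nabla f(\theta_\star,Z)\|^{1+\alpha}]<\infty$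 for some $\alpha\in(0,1]$; and for every compact $\Theta\subset\mathbb{R}^d$ there is a measurable $M_\Theta:\mathsf{Z}\to[0,\infty)$ with $\mathbb{E}[M_\Theta(Z)]<\infty$ such that, $\mathbb{P}$-a.s., $\|\nabla^2 f(\theta,Z)-\nabla^2 f(\theta',Z)\|\le M_\Theta(Z)\|\theta-\theta'\|$ for all $(\theta,\theta')\in\Theta^2$. For real random variables $X_B$ and $a_B>0$, $X_B=O_{\mathbb{P}}(a_B)$ means that for every $\epsilon\in(0,1)$ there is a finite $M_\epsilon$ with $\limsup_{B\to\infty}\mathbb{P}(|X_B/a_B|\ge M_\epsilon)\le\epsilon$. Costs. $C_{\mathrm{grad}},C_{\mathrm{eval}}\in\mathbb{N}$ are fixed constants: the costs of computing $\nabla f(\theta,z)$, respectively $f(\theta,z)$, at one pair $(\theta,z)$. Procedure $\mathrm{GD}(\theta_0,n,B,\tau,\beta)$ (gradient descent with backtracking line search), with $\theta_0\in\mathbb{R}^d$, sample size $n$, budget $B$, tolerance $\tau\ge0$, $\beta\in(0,1)$: 1. Set $t=0$, $\theta_{B,0}=\theta_0$, $\tilde B=B$. 2. If $\tilde B\ge nC_{\mathrm{grad}}$: set $G_0=\nabla F_n(\theta_{B,0})$ and $\tilde B\leftarrow\tilde B-nC_{\mathrm{grad}}$. Then, if $\tilde B\ge nC_{\mathrm{eval}}$: set $g_0=F_n(\theta_{B,0})$ and $\tilde B\leftarrow\tilde B-nC_{\mathrm{eval}}$. 3. While $\|G_t\|>\tau$ and $\tilde B\ge nC_{\mathrm{eval}}$: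 (a) set $g_t'=F_n(\theta_{B,t}-G_t)$, $v_{t+1}=1$, $\tilde B\leftarrow\tilde B-nC_{\mathrm{eval}}$; (b) while $g_t'>g_t-\frac{v_{t+1}}2\|G_t\|^2$ and $\tilde B\ge nC_{\mathrm{eval}}$: $v_{t+1}\leftarrow\beta v_{t+1}$, $g_t'\leftarrow F_n(\theta_{B,t}-v_{t+1}G_t)$, $\tilde B\leftarrow\tilde B-nC_{\mathrm{eval}}$; (c) if $g_t'\le g_t-\frac{v_{t+1}}2\|G_t\|^2$: set $\theta_{B,t+1}=\theta_{B,t}-v_{t+1}G_t$, $g_{t+1}=g_t'$, $t\leftarrow t+1$; then, if $\tilde B\ge nC_{\mathrm{grad}}$, set $G_t=\nabla F_n(\theta_{B,t})$ and $\tilde B\leftarrow\tilde B-nC_{\mathrm{grad}}$, otherwise leave the loop of step 3. 4. Return $(\theta_{B,t},\max(\tilde B,0))$. If $G_0$ was not computed in step 2, the loop of step 3 is not entered. *)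

(* Defs.v *)
(* Vectors of R^d are row vectors ['rV[R]_d], and a matrix acts on them by
   [v *m A], as for the library's [jacobian]. *)
From HB Require Import structures.
From mathcomp Require Import all_boot all_order all_algebra finmap.
From mathcomp Require Import all_classical all_reals all_analysis.
Set Implicit Arguments.
Unset Strict Implicit.
Unset Printing Implicit Defensive.
Import Order.TTheory GRing.Theory Num.Theory.
Import numFieldNormedType.Exports.
Local Open Scope classical_set_scope.
Local Open Scope ring_scope.

(* The library's norm on ['rV[R]_d] is the sup norm; it is used only for the
   topology and for differentiability, where the choice of norm is immaterial. *)
Definition enorm (R : realType) (d : nat) (v : 'rV[R]_d) : R :=
  Num.sqrt (\sum_(i < d) v 0 i ^+ 2).

Definition opnorm (R : realType) (d : nat) (A : 'M[R]_d) : R :=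
  sup [set enorm (v *m A) | v in [set v : 'rV[R]_d | enorm v <= 1]].

Definition gradient (R : realType) (d : nat) (g : 'rV[R]_d -> R)
    (theta : 'rV[R]_d) : 'rV[R]_d :=
  \row_(i < d) 'd g theta (delta_mx 0 i).

Definition hessian (R : realType) (d : nat) (g : 'rV[R]_d -> R)
    (theta : 'rV[R]_d) : 'M[R]_d :=
  jacobian (gradient g) theta.

Definition twice_continuously_differentiable (R : realType) (d : nat)
    (g : 'rV[R]_d -> R) : Prop :=
  [/\ forall theta, differentiable g theta,
      forall theta, differentiable (gradient g) theta
    & continuous (hessian g)].

Definition strictly_convex (R : realType) (d : nat) (F : 'rV[R]_d -> R) : Prop :=
  forall (a : R) (x y : 'rV[R]_d), 0 < a < 1 -> x != y ->
    F (a *: x + (1 - a) *: y) < a * F x + (1 - a) * F y.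

Definition is_minimizer (R : realType) (d : nat) (F : 'rV[R]_d -> R)
    (x : 'rV[R]_d) : Prop :=
  forall y, F x <= F y.

Notation borel T := (g_sigma_algebraType (@open T)).

Definition separable (T : topologicalType) : Prop :=
  exists2 D : set T, countable D & dense D.

Definition completely_metrizable (R : realType) (T : topologicalType) : Prop :=
  exists dist : T -> T -> R,
    [/\ [/\ forall x y, 0 <= dist x y, forall x y, dist x y = 0 <-> x = y,
            forall x y, dist x y = dist y x
          & forall x y z, dist x z <= dist x y + dist y z],
        forall x, nbhs x = nbhs_ball_ (fun c e => [set y | dist c y < e]) x
      & forall u : nat -> T,
          (forall e : R, 0 < e -> exists N, forall i j,
             (N <= i)%N -> (N <= j)%N -> dist (u i) (u j) < e) ->
          exists l : T, u @ \oo --> l].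

Definition polish (R : realType) (T : topologicalType) : Prop :=
  separable T /\ completely_metrizable R T.

Definition mutually_independent (d d' : measure_display) (T : measurableType d)
    (T' : measurableType d') (R : realType) (P : probability T R)
    (X : nat -> {RV P >-> T'}) : Prop :=
  forall (J : {fset nat}) (A : nat -> set T'),
    (forall i, measurable (A i)) ->
    P (\bigcap_(i in [set` J]) (X i @^-1` A i)) =
    (\prod_(i <- J) P (X i @^-1` A i))%E.

Definition iid_copies (d d' : measure_display) (T : measurableType d)
    (T' : measurableType d') (R : realType) (P : probability T R)
    (Z : {RV P >-> T'}) (Zs : nat -> {RV P >-> T'}) : Prop :=
  mutually_independent Zs /\
  forall i (A : set T'), measurable A -> distribution P (Zs i) A = distribution P Z A.

(* [X B = O_P(a B)] as [B -> oo], with [B >= 1]; that the [X B] are random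
   variables is part of the notion, so that [P] below is applied to events. *)
Definition bigO_P (d : measure_display) (T : measurableType d) (R : realType)
    (P : probability T R) (X : nat -> T -> R) (a : nat -> R) : Prop :=
  (forall B, (0 < B)%N -> measurable_fun [set: T] (X B)) /\
  forall eps : R, 0 < eps < 1 -> exists M : R,
    (limn_esup (fun B => P [set w | (M <= `|X B w / a B|)%R]) <= eps%:E)%E.

Definition locally_strongly_convex (R : realType) (d : nat) (F : 'rV[R]_d -> R) : Prop :=
  forall Theta : set 'rV[R]_d, compact Theta ->
  exists2 c : R, 0 < c &
    forall (a : R) (x y : 'rV[R]_d), 0 <= a <= 1 -> Theta x -> Theta y ->
      F (a *: x + (1 - a) *: y) <=
      a * F x + (1 - a) * F y - c / 2 * a * (1 - a) * enorm (x - y) ^+ 2.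

Definition regular_objective (R : realType) (dOm : measure_display)
    (Om : measurableType dOm) (P : probability Om R) (ZT : ptopologicalType)
    (Z : {RV P >-> borel ZT}) (d : nat) (f : 'rV[R]_d -> ZT -> R)
    (thetastar : 'rV[R]_d) (alpha : R) : Prop :=
  [/\ forall z, twice_continuously_differentiable (f ^~ z),
      ('E_P[fun w => opnorm (hessian (f ^~ (Z w)) thetastar)] < +oo)%E,
      ('E_P[fun w => (enorm (gradient (f ^~ (Z w)) thetastar) `^ (1 + alpha))%R]
         < +oo)%E
    & forall Theta : set 'rV[R]_d, compact Theta ->
      exists M : ZT -> R,
        [/\ measurable_fun [set: borel ZT] M, forall z, 0 <= M z,
            ('E_P[fun w => M (Z w)] < +oo)%E
          & {ae P, forall w, forall x y, Theta x -> Theta y ->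
              opnorm (hessian (f ^~ (Z w)) x - hessian (f ^~ (Z w)) y)
              <= M (Z w) * enorm (x - y)}]].

(* [zs i] is the (i+1)-st observation. *)
Definition empirical_objective (R : realType) (d : nat) (ZT : Type)
    (f : 'rV[R]_d -> ZT -> R) (zs : nat -> ZT) (n : nat) (theta : 'rV[R]_d) : R :=
  n%:R^-1 * \sum_(i < n) f theta (zs i).

(* [while k test body s] is the loop "while test do body" started in [s], cut
   after [k] rounds. In the loops below each round spends at least one unit of
   budget, so taking the available budget for [k] never cuts the loop; see
   [while_exit], [line_search_exit] and [gd_exit]. *)
Fixpoint while (S : Type) (k : nat) (test : S -> bool) (body : S -> S) (s : S) : S :=
  if k is k'.+1 then
    if test s then while k' test body (body s) else s
  else s.

Lemma while_exit (S : Type) (m : S -> nat) (test : S -> bool) (body : S -> S)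
    (k : nat) (s : S) :
  (forall s, test s -> (m (body s) < m s)%N) -> (m s <= k)%N ->
  ~~ test (while k test body s).
Proof.
move=> dec; elim: k s => [|k IHk] s ms /=.
  by apply/negP => /dec; rewrite ltnNge (leq_trans ms).
case: ifPn => // ts; apply: IHk.
by rewrite -ltnS (leq_trans (dec _ ts)).
Qed.

Section GradientDescent.
Context (R : realType) (d : nat).
(* [Fn] is the objective; [cgrad], [ceval] are the costs of one evaluation of
   its gradient, resp. of its value. *)
Context (Fn : 'rV[R]_d -> R) (cgrad ceval : nat) (tau beta : R).

(* State [(v, g', b)] of the line search: step size, trial value, budget. *)
Definition ls_test (g : R) (G : 'rV[R]_d) (s : R * R * nat) : bool :=
  let: (v, g', b) := s in
  (g - v / 2 * enorm G ^+ 2 < g') && (ceval <= b)%N.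

Definition ls_body (theta G : 'rV[R]_d) (s : R * R * nat) : R * R * nat :=
  let: (v, g', b) := s in
  (beta * v, Fn (theta - (beta * v) *: G), (b - ceval)%N).

(* The first trial, with step size 1, and the backtracking that follows it; to
   be entered with [ceval <= b]. *)
Definition line_search (theta : 'rV[R]_d) (g : R) (G : 'rV[R]_d) (b : nat) :
    R * R * nat :=
  while b (ls_test g G) (ls_body theta G) (1, Fn (theta - G), (b - ceval)%N).

(* [gd_grad] is [None] when the gradient at the current iterate could not be
   afforded; the main loop is then not entered, or is left. *)
Record gd_state := GDState {
  gd_iterate : 'rV[R]_d;
  gd_value : R;
  gd_grad : option 'rV[R]_d;
  gd_budget : nat
}.

(* If the initial value cannot be afforded, [gd_value] is a placeholder: the main
   loop is then not entered, as the budget is below [ceval] or [gd_grad] is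
   [None]. *)
Definition gd_init (theta0 : 'rV[R]_d) (B : nat) : gd_state :=
  if (cgrad <= B)%N then
    let b := (B - cgrad)%N in
    if (ceval <= b)%N
    then GDState theta0 (Fn theta0) (Some (gradient Fn theta0)) (b - ceval)%N
    else GDState theta0 0 (Some (gradient Fn theta0)) b
  else GDState theta0 0 None B.

Definition gd_test (s : gd_state) : bool :=
  if gd_grad s is Some G then (tau < enorm G) && (ceval <= gd_budget s)%N
  else false.

Definition gd_body (s : gd_state) : gd_state :=
  if gd_grad s is Some G then
    let theta := gd_iterate s in
    let g := gd_value s in
    let: (v, g', b) := line_search theta g G (gd_budget s) in
    if g' <= g - v / 2 * enorm G ^+ 2 then
      let theta' := theta - v *: G in
      if (cgrad <= b)%N
      then GDState theta' g' (Some (gradient Fn theta')) (b - cgrad)%N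
      else GDState theta' g' None b
    else GDState theta g (Some G) b
  else s.

Definition gd_run (theta0 : 'rV[R]_d) (B : nat) : gd_state :=
  let s0 := gd_init theta0 B in while (gd_budget s0) gd_test gd_body s0.

Lemma line_search_exit theta g G b : (0 < ceval)%N ->
  ~~ ls_test g G (line_search theta g G b).
Proof.
move=> c0; apply: (@while_exit _ (fun s => s.2)); last exact: leq_subr.
move=> [[v g'] b'] /andP[_ cb] /=.
by rewrite ltn_subrL c0 (leq_trans c0).
Qed.

Lemma line_search_budget theta g G b :
  ((line_search theta g G b).2 <= b - ceval)%N.
Proof.
have dec k s : ((while k (ls_test g G) (ls_body theta G) s).2 <= s.2)%N.
  elim: k s => [|k IHk] [[v g'] b'] //=; case: ifP => // _.
  by apply: leq_trans (IHk _) _; exact: leq_subr.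
exact: dec.
Qed.

Lemma gd_exit theta0 B : (0 < ceval)%N -> ~~ gd_test (gd_run theta0 B).
Proof.
move=> c0; apply: (@while_exit _ gd_budget) => // -[theta g [G|] b] //=.
rewrite /gd_test /gd_body /= => /andP[_ cb].
have := line_search_budget theta g G b.
case: line_search => [[v g'] b'] /= b'b.
have lt_b'b : (b' < b)%N.
  by rewrite (leq_ltn_trans b'b)// ltn_subrL c0 (leq_trans c0).
case: ifP => _ //; case: ifP => _ //=.
exact: leq_ltn_trans (leq_subr _ _) lt_b'b.
Qed.

End GradientDescent.

(* Gradient descent on the empirical objective of [zs 0], ..., [zs n.-1]. The
   result is the last iterate and the remaining budget. The budget is a natural
   number from which a cost is subtracted only when it is covered, so that the
   remaining budget [b] satisfies [max(b, 0) = b]. *)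
Definition GD (R : realType) (d : nat) (ZT : Type) (f : 'rV[R]_d -> ZT -> R)
    (zs : nat -> ZT) (Cgrad Ceval : nat) (theta0 : 'rV[R]_d) (n B : nat)
    (tau beta : R) : 'rV[R]_d * nat :=
  let s := gd_run (empirical_objective f zs n) (n * Cgrad)%N (n * Ceval)%N
             tau beta theta0 B in
  (gd_iterate s, gd_budget s).

(* Main.v *)
Require Import Defs.
From HB Require Import structures.
From mathcomp Require Import all_boot all_order all_algebra finmap.
From mathcomp Require Import all_classical all_reals all_analysis.
From mathcomp Require Import measurable_realfun.
From mathcomp Require Import ring lra zify.
Set Implicit Arguments.
Unset Strict Implicit.
Unset Printing Implicit Defensive.
Import Order.TTheory GRing.Theory Num.Theory.
Import numFieldNormedType.Exports.
Local Open Scope classical_set_scope.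
Local Open Scope ring_scope.

(** The error of the returned point splits into a statistical part, governed by the
    gradient [e] of the empirical objective [F_n] at [theta_*], and an optimization
    part, governed by the number of steps of order [B / n] that the budget allows.
    Everything is compared with [theta_*] and not with a minimizer of [F_n], which
    need not exist, since the sampled functions are not convex.

    Deterministic part. Suppose that [F_n] is strongly convex and smooth on a large
    enough ball around [theta_*] and that [e] is small. A step accepted by the line
    search decreases [F_n] by a multiple of the squared gradient, which bounds
    [F_n - F_n theta_*] from above ([polyak_lojasiewicz]); hence this gap contracts,
    and after [T] steps it is [O(1 / T)]. Steps of size at most one cannot leave the
    large ball, and the points of the large ball where [F_n] is below its initial
    value lie in a smaller ball ([sublevel_bounded]), so the iterates never escape to
    a region where nothing is known. Quadratic growth around [theta_*] turns the gap
    into a distance: the squared error is [O(n / B + |e|^2)] ([gd_run_dist]).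

    Probabilistic part. The Hessian of [F_n] is, with probability tending to one,
    bounded below and above on any fixed ball ([empirical_hessian_whp]): its mean
    inherits the strong convexity of [F] ([mean_hessian_ge]), the weak law of large
    numbers applies at the points of a finite net, and the integrable Lipschitz
    constant extends the bounds from the net to the ball. Since [theta_*] minimizes
    [F], the summands of [e] are centred ([Ex_gradient_star]); with [1 + alpha]
    moments, truncation and the inequalities of Chebyshev and Markov give
    [e = O_P(n ^ (- alpha / (1 + alpha)))] ([mean_rate]).

    Finally, [n / B] is of the order of [n ^ (- 2 alpha / (1 + alpha))] for the given
    growth of [n] ([sample_budget_ratio]): both parts have the same order, and the
    [O(1 / T)] decay, much weaker than the true linear rate, is just enough.

    The notion of [O_P] includes that the errors are random variables. The algorithm
    is therefore followed step by step: gradients are limits of difference quotients,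
    and loops with a random number of rounds are cut according to that number
    ([measurable_gd_run]). *)

(** * Taylor expansion along segments *)

Section Euclidean.
Context {R : realType} {d : nat}.
Implicit Types (u v w x y : 'rV[R]_d) (A B : 'M[R]_d).

Definition dot u v : R := \sum_(i < d) u 0 i * v 0 i.

Definition quad A u : R := dot (u *m A) u.

Lemma enorm_sqr v : enorm v ^+ 2 = dot v v.
Proof. by rewrite sqr_sqrtr ?sumr_ge0// => i _; rewrite sqr_ge0. Qed.

Lemma enorm_ge0 v : 0 <= enorm v. Proof. exact: sqrtr_ge0. Qed.

Lemma dotDl u v w : dot (u + v) w = dot u w + dot v w.
Proof. by rewrite -big_split; apply: eq_bigr => i _; rewrite mxE mulrDl. Qed.

Lemma dotZl a u v : dot (a *: u) v = a * dot u v.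
Proof. by rewrite mulr_sumr; apply: eq_bigr => i _; rewrite mxE mulrA. Qed.

Lemma dotC u v : dot u v = dot v u.
Proof. by apply: eq_bigr => i _; rewrite mulrC. Qed.

Lemma dotZr a u v : dot v (a *: u) = a * dot v u.
Proof. by rewrite !(dotC v) dotZl. Qed.

Lemma dotNl u v : dot (- u) v = - dot u v.
Proof. by rewrite -scaleN1r dotZl mulN1r. Qed.

Lemma dotNr u v : dot v (- u) = - dot v u.
Proof. by rewrite !(dotC v) dotNl. Qed.

Lemma dot_deltal i u : dot (delta_mx 0 i) u = u 0 i.
Proof.
rewrite /dot (bigD1 i)//= big1 ?addr0 ?mxE ?eqxx ?mul1r// => j ji.
by rewrite mxE (negPf ji) andbF mul0r.
Qed.

Lemma dot_ge0 u : 0 <= dot u u.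
Proof. by apply: sumr_ge0 => i _; rewrite -expr2 sqr_ge0. Qed.

(** Young's inequality, obtained coordinatewise by completing squares; it replaces
    every use of the Cauchy-Schwarz inequality. *)
Lemma dot_young (a : R) u v : 0 < a ->
  - (dot u u / (2 * a)) <= dot u v + a / 2 * dot v v.
Proof.
move=> a0; rewrite -subr_ge0.
have -> : dot u v + a / 2 * dot v v - - (dot u u / (2 * a)) =
    \sum_(i < d) (u 0 i + a * v 0 i) ^+ 2 / (2 * a).
  rewrite /dot opprK mulr_sumr mulr_suml -!big_split/=.
  by apply: eq_bigr => i _; field; rewrite gt_eqF.
apply: sumr_ge0 => i _.
by rewrite divr_ge0 ?sqr_ge0// mulr_ge0// ltW.
Qed.

Lemma normr_coord u i : `|u 0 i| <= `|u|.
Proof.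
rewrite [leRHS]/Num.Def.normr/= mx_normrE.
exact: (le_bigmax _ (fun ij : 'I_1 * 'I_d => `|u ij.1 ij.2|) (0, i)).
Qed.

Lemma normr_le_coord (c : R) u : 0 <= c -> (forall i, `|u 0 i| <= c) -> `|u| <= c.
Proof.
move=> c0 uc; rewrite [leLHS]/Num.Def.normr/= mx_normrE.
by apply: bigmax_le => // -[i j] _; rewrite (ord1 i).
Qed.

Lemma sqr_coord_le_dot u i : u 0 i ^+ 2 <= dot u u.
Proof.
rewrite /dot (bigD1 i)//= expr2 lerDl; apply: sumr_ge0 => j _.
by rewrite -expr2 sqr_ge0.
Qed.

Lemma normr_sqr_le_dot u : `|u| ^+ 2 <= dot u u.
Proof.
rewrite -[leRHS]enorm_sqr lerXn2r ?nnegrE ?enorm_ge0//.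
apply: normr_le_coord => [|i]; first exact: enorm_ge0.
by rewrite -sqrtr_sqr ler_wsqrtr// sqr_coord_le_dot.
Qed.

Lemma dot_le_normr_sqr u : dot u u <= d%:R * `|u| ^+ 2.
Proof.
have -> : d%:R * `|u| ^+ 2 = \sum_(i < d) `|u| ^+ 2.
  by rewrite sumr_const card_ord mulr_natl.
apply: ler_sum => i _; rewrite -expr2 -real_normK ?num_real//.
by rewrite lerXn2r ?nnegrE// normr_coord.
Qed.

Lemma enorm_le_normr u : enorm u <= d%:R * `|u|.
Proof.
rewrite -(@ler_pXn2r _ 2)// ?nnegrE ?enorm_ge0 ?mulr_ge0// enorm_sqr.
apply: le_trans (dot_le_normr_sqr u) _; rewrite exprMn.
rewrite ler_wpM2r ?sqr_ge0// -natrX ler_nat.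
by case: (d) => // k; exact: leq_pmull.
Qed.

Lemma subr_entry A B i j : (A - B) i j = A i j - B i j.
Proof. by rewrite !mxE. Qed.

Lemma quadE A u : quad A u = \sum_(j < d) \sum_(i < d) u 0 i * A i j * u 0 j.
Proof. by apply: eq_bigr => j _; rewrite mxE mulr_suml. Qed.

Lemma quadZ A (a : R) u : quad A (a *: u) = a ^+ 2 * quad A u.
Proof. by rewrite /quad -scalemxAl dotZl dotZr mulrA expr2. Qed.

Lemma quadN A u : quad A (- u) = quad A u.
Proof. by rewrite -scaleN1r quadZ sqrrN expr1n mul1r. Qed.

Lemma quadB A B u : quad (A - B) u = quad A u - quad B u.
Proof. by rewrite /quad mulmxBr dotDl dotNl. Qed.

Lemma quad_remainder A B u (p q t : R) : p = q + t + quad A u / 2 ->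
  p - q - t - quad B u / 2 = quad (A - B) u / 2.
Proof. by move=> ->; rewrite quadB; lra. Qed.

Lemma quad_bound A (L : R) u : 0 <= L -> (forall i j, `|A i j| <= L) ->
  `|quad A u| <= d%:R * L * dot u u.
Proof.
move=> L0 AL; rewrite quadE; apply: le_trans (ler_norm_sum _ _ _) _.
have -> : d%:R * L * dot u u =
    \sum_(j < d) \sum_(i < d) L / 2 * (u 0 i ^+ 2 + u 0 j ^+ 2).
  under eq_bigr do rewrite -mulr_sumr big_split/= sumr_const card_ord.
  rewrite -mulr_sumr big_split/= sumr_const card_ord sumrMnl.
  under [in RHS]eq_bigr do rewrite expr2.
  by rewrite -/(dot u u) -mulr_natl; field.
apply: ler_sum => j _; apply: le_trans (ler_norm_sum _ _ _) _.
apply: ler_sum => i _; rewrite !normrM.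
have := AL i j; have := normr_ge0 (A i j).
rewrite -(real_normK (num_real (u 0 i))) -(real_normK (num_real (u 0 j))).
set p := `|u 0 i|; set q := `|u 0 j|; move=> A0 AL'.
apply: (@le_trans _ _ (p * L * q)); last first.
  have := mulr_ge0 L0 (sqr_ge0 (p - q)); nra.
by apply: ler_wpM2r; [exact: normr_ge0|apply: ler_wpM2l => //; exact: normr_ge0].
Qed.

Lemma coord_le_enorm u i : `|u 0 i| <= enorm u.
Proof. by rewrite -sqrtr_sqr ler_wsqrtr// sqr_coord_le_dot. Qed.

Lemma opnorm_entry A i j : `|A i j| <= opnorm A.
Proof.
have di1 : enorm (delta_mx 0 i : 'rV[R]_d) = 1.
  rewrite -[LHS]ger0_norm ?enorm_ge0// -sqrtr_sqr enorm_sqr dot_deltal.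
  by rewrite mxE !eqxx sqrtr1.
apply: (@le_trans _ _ (enorm (delta_mx 0 i *m A))).
  have := coord_le_enorm (delta_mx 0 i *m A) j.
  by rewrite -rowE mxE.
apply: ub_le_sup; last by exists (delta_mx 0 i) => //=; rewrite di1.
exists (d%:R * \sum_(k < d) \sum_(l < d) `|A k l|) => _ [v /= v1 <-].
apply: le_trans (enorm_le_normr _) _; rewrite ler_wpM2l//.
apply: normr_le_coord => [|l].
  by apply: sumr_ge0 => k _; exact: sumr_ge0.
rewrite mxE; apply: le_trans (ler_norm_sum _ _ _) _.
apply: ler_sum => k _; rewrite normrM.
apply: (@le_trans _ _ `|A k l|).
  by rewrite ler_piMl// (le_trans (coord_le_enorm _ _)).
by rewrite (bigD1 l)//= lerDl sumr_ge0.
Qed.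

End Euclidean.

Section Segments.
Context {R : realType} {d : nat}.
Implicit Types (g : 'rV[R]_d -> R) (x y h : 'rV[R]_d).

Lemma diff_gradient g x h : differentiable g x -> 'd g x h = dot (gradient g x) h.
Proof.
move=> dg; rewrite [in LHS](row_sum_delta h) linear_sum.
by apply: eq_bigr => i _; rewrite linearZ/= mxE mulrC.
Qed.

(** The difference quotients of the restriction of [G] to a line are exactly those of
    the directional derivative, so no chain rule is involved. *)
Lemma is_derive_line (W : normedModType R) (G : 'rV[R]_d -> W) x h (s : R) :
  differentiable G (x + s *: h) ->
  is_derive s 1 (fun s => G (x + s *: h)) ('d G (x + s *: h) h).
Proof.
move=> dG; rewrite -deriveE//.
have E : (fun e : R => e^-1 *: (((fun s => G (x + s *: h)) \o shift s) (e *: 1) -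
      G (x + s *: h))) =
    (fun e => e^-1 *: ((G \o shift (x + s *: h)) (e *: h) - G (x + s *: h))).
  apply/funext => e /=; congr (_ *: (G _ - _)).
  by rewrite [e *: 1]mulr1 scalerDl addrCA.
by apply: DeriveDef; rewrite /derivable /derive E//; exact: diff_derivable.
Qed.

Lemma hessianE g x i j :
  hessian g x i j = 'd (gradient g) x (delta_mx 0 i) 0 j.
Proof. by rewrite /hessian /jacobian mxE. Qed.

Lemma is_derive_line_gradient g x h (s : R) j :
  differentiable (gradient g) (x + s *: h) ->
  is_derive s 1 (fun s => gradient g (x + s *: h) 0 j)
    ((h *m hessian g (x + s *: h)) 0 j).
Proof.
move=> dg; have := is_derive_line dg.
rewrite -deriveE// deriveEjacobian// -/(hessian g _) => -[dl <-].
have /derivable_mxP dl' := dl.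
by rewrite derive_mx// mxE; exact: DeriveDef.
Qed.

(** With [phi s = g (x + s h)], the constant [K] is chosen so that
    [phi s + (1 - s) phi' s + K (1 - s)^2] takes the same value at [0] and [1];
    Rolle's theorem then identifies [2 K] as a value of [phi'']. *)
Lemma taylor2 g x h :
  (forall p, differentiable g p) -> (forall p, differentiable (gradient g) p) ->
  exists2 s : R, 0 <= s <= 1 &
    g (x + h) = g x + dot (gradient g x) h + quad (hessian g (x + s *: h)) h / 2.
Proof.
move=> dg dG.
pose phi s := g (x + s *: h).
pose psi s := dot (gradient g (x + s *: h)) h.
pose psi' s := quad (hessian g (x + s *: h)) h.
have Dphi (s : R) : is_derive s (1 : R) phi (psi s).
  by rewrite /psi -diff_gradient//; exact: is_derive_line.
have Dpsi (s : R) : is_derive s (1 : R) psi (psi' s).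
  have -> : psi = \sum_(i < d) (fun s => h 0 i * gradient g (x + s *: h) 0 i).
    by apply/funext => r; rewrite fct_sumE; apply: eq_bigr => i _; rewrite mulrC.
  have -> : psi' s = \sum_(i < d) h 0 i *: (h *m hessian g (x + s *: h)) 0 i.
    by apply: eq_bigr => i _; rewrite mulrC.
  apply: is_derive_sum => i; apply: is_deriveZ.
  exact: is_derive_line_gradient.
pose K := phi 1 - phi 0 - psi 0.
pose chi : R -> R := fun s => phi s + (1 - s) * psi s + K * (1 - s) ^+ 2.
have Dchi (s : R) : is_derive s (1 : R) chi ((1 - s) * (psi' s - 2 * K)).
  have D1 : is_derive s (1 : R) (fun r : R => 1 - r) (- 1).
    by rewrite -[- 1]add0r; apply: is_deriveB.
  have -> : chi = phi + (fun r => 1 - r) * psi +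
      K *: ((fun r => 1 - r) * (fun r => 1 - r)).
    by apply/funext => r; rewrite /chi expr2.
  apply: is_derive_eq (is_deriveD (is_deriveD (Dphi s) (is_deriveM D1 (Dpsi s)))
    (is_deriveZ K (is_deriveM D1 D1))) _.
  by rewrite /GRing.scale/=; ring.
have cchi : {within `[0, 1], continuous chi}.
  apply: continuous_subspaceT => s.
  by apply: differentiable_continuous; apply/derivable1_diffP; have [] := Dchi s.
have dchi s : s \in `]0, 1[ -> derivable chi s 1 by have [] := Dchi s.
have chi01 : chi 0 = chi 1 by rewrite /chi/K; move: (phi 1) (phi 0) (psi 0) (psi 1) => *; ring.
have [c c01 [_ Dc]] := Rolle ltr01 dchi cchi chi01.
exists c; first by rewrite !ltW ?(itvP c01).
have [_] := Dchi c; rewrite Dc => /esym/eqP; rewrite mulf_eq0 subr_eq0.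
rewrite gt_eqF ?(itvP c01)//= subr_eq0 => /eqP psi'c.
rewrite -/(psi' c) psi'c.
have -> : g (x + h) = phi 1 by rewrite /phi scale1r.
have -> : g x = phi 0 by rewrite /phi scale0r addr0.
have -> : dot (gradient g x) h = psi 0 by rewrite /psi scale0r addr0.
by rewrite /K; move: (phi 1) (phi 0) (psi 0) => *; field.
Qed.

Lemma gradient_mvt g x h j : (forall p, differentiable (gradient g) p) ->
  exists2 s : R, 0 <= s <= 1 &
    gradient g (x + h) 0 j - gradient g x 0 j =
      (h *m hessian g (x + s *: h)) 0 j.
Proof.
move=> dG.
have D s := is_derive_line_gradient j (dG (x + s *: h)).
have cG : {within `[0, 1], continuous (fun s => gradient g (x + s *: h) 0 j)}.
  apply: continuous_subspaceT => s.
  by apply: differentiable_continuous; apply/derivable1_diffP; have [] := D s.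
have [c c01] := MVT ltr01 (fun s _ => D s) cG.
rewrite scale1r scale0r addr0 subr0 mulr1 => E.
by exists c; first by rewrite !ltW ?(itvP c01).
Qed.

End Segments.

(** * Derivatives of the empirical objective *)

Section EmpiricalDerivatives.
Context {R : realType} {d : nat} {ZT : Type}.
Variables (f : 'rV[R]_d -> ZT -> R) (zs : nat -> ZT) (n : nat).

Definition mean (T : Type) (q : T -> R) (ts : nat -> T) : R :=
  n%:R^-1 * \sum_(i < n) q (ts i).

Lemma mean_lipschitz (T : Type) (q q' M : T -> R) (ts : nat -> T) (delta : R) :
  (forall i, `|q (ts i) - q' (ts i)| <= M (ts i) * delta) ->
  `|mean q ts - mean q' ts| <= mean M ts * delta.
Proof.
move=> H; rewrite /mean -mulrBr -sumrB normrM ger0_norm ?invr_ge0// -mulrA.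
rewrite ler_wpM2l ?invr_ge0// mulr_suml.
by apply: le_trans (ler_norm_sum _ _ _) _; exact: ler_sum.
Qed.

Hypothesis df : forall z p, differentiable (f ^~ z) p.
Hypothesis dGf : forall z p, differentiable (gradient (f ^~ z)) p.

Let Fn := empirical_objective f zs n.

Lemma empirical_objectiveE : Fn = n%:R^-1 *: \sum_(i < n) f ^~ (zs i).
Proof. by apply/funext => p; rewrite fctE fct_sumE. Qed.

Lemma differentiable_empirical_objective p : differentiable Fn p.
Proof.
rewrite empirical_objectiveE.
by apply: differentiableZ; apply: differentiable_sum.
Qed.

Lemma gradient_empirical_objective p :
  gradient Fn p = n%:R^-1 *: \sum_(i < n) gradient (f ^~ (zs i)) p.
Proof.
apply/rowP => k; rewrite !mxE summxE -deriveE; last first.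
  exact: differentiable_empirical_objective.
rewrite empirical_objectiveE deriveZ; last first.
  by apply: derivable_sum => i; exact: diff_derivable.
rewrite derive_sum; last by move=> i; exact: diff_derivable.
rewrite /GRing.scale/=; congr (_ * _).
by apply: eq_bigr => i _; rewrite mxE deriveE.
Qed.

Lemma differentiable_gradient_empirical_objective p : differentiable (gradient Fn) p.
Proof.
have -> : gradient Fn = n%:R^-1 *: \sum_(i < n) gradient (f ^~ (zs i)).
  by apply/funext => q; rewrite gradient_empirical_objective fctE fct_sumE.
by apply: differentiableZ; apply: differentiable_sum.
Qed.

Lemma gradient_empirical_entry p k :
  gradient Fn p 0 k = mean (fun z => gradient (f ^~ z) p 0 k) zs.
Proof. by rewrite gradient_empirical_objective mxE summxE. Qed.

Lemma hessian_empirical_entry p k l :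
  hessian Fn p k l = mean (fun z => hessian (f ^~ z) p k l) zs.
Proof.
transitivity ('D_(delta_mx 0 k) (gradient Fn) p 0 l).
  by rewrite hessianE deriveE//; exact: differentiable_gradient_empirical_objective.
have -> : gradient Fn = n%:R^-1 *: \sum_(i < n) gradient (f ^~ (zs i)).
  by apply/funext => q; rewrite gradient_empirical_objective fctE fct_sumE.
rewrite deriveZ; last by apply: derivable_sum => i; exact: diff_derivable.
rewrite derive_sum; last by move=> i; exact: diff_derivable.
rewrite mxE summxE; congr (_ * _).
by apply: eq_bigr => i _; rewrite deriveE// hessianE.
Qed.

End EmpiricalDerivatives.

(** * Deterministic convergence of gradient descent *)

Lemma while_invariant (S : Type) (I : S -> Prop) (test : S -> bool) (body : S -> S)
    (k : nat) (s : S) :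
  (forall s, I s -> test s -> I (body s)) -> I s -> I (while k test body s).
Proof.
by move=> step; elim: k s => //= k IHk s Is; case: ifPn => // ts; exact/IHk/step.
Qed.

Lemma leq_spend (B b x W T : nat) :
  (B <= b + T)%N -> (x <= W)%N -> (B <= b - x + (W + T))%N.
Proof. by lia. Qed.

(** One step of a contraction by [1 - k], weakened to a decay like [1 / (T k)]. The
    sign of the gap [e] is unknown, because the reference value is not a minimum; a
    negative gap is better than the bound claims. *)
Lemma harmonic_decay (R : realFieldType) (k T D e e' : R) :
  0 < k <= 1 -> 0 <= T -> 0 <= D -> (1 + T * k) * e <= D -> e' <= (1 - k) * e ->
  e' <= D /\ (1 + (T + 1) * k) * e' <= D.
Proof.
move=> /andP[k0 k1] T0 D0 eD e'e.
have Tk0 : 0 <= T * k by rewrite mulr_ge0// ltW.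
have [e0|e0] := leP 0 e; last first.
  have e'0 : e' <= 0.
    by apply: le_trans e'e _; rewrite mulr_ge0_le0 ?subr_ge0// ltW.
  split; first exact: le_trans D0.
  by apply: le_trans D0; rewrite mulr_ge0_le0//; nra.
have Tke0 : 0 <= T * k * e by exact: mulr_ge0.
have ke0 : 0 <= k * e by apply: mulr_ge0 => //; exact: ltW.
split; first lra.
apply: le_trans eD; have := ler_wpM2l Tk0 e'e.
have : k * e' <= k * e by rewrite ler_wpM2l ?(ltW k0)//; lra.
have : 0 <= T * k * (k * e) by exact: mulr_ge0.
lra.
Qed.

Section Deterministic.
Context {R : realType} {d : nat}.
Variable g : 'rV[R]_d -> R.
Hypothesis dg : forall p, differentiable g p.
Hypothesis dG : forall p, differentiable (gradient g) p.
Implicit Types (x y c : 'rV[R]_d) (a L r : R).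

Definition hessian_ge c r a := forall x u, `|x - c| <= r ->
  a * dot u u <= quad (hessian g x) u.

Definition hessian_entries_le c r L := forall x i j, `|x - c| <= r ->
  `|hessian g x i j| <= L.

Lemma ball_convex c r x y (s : R) : 0 <= s <= 1 ->
  `|x - c| <= r -> `|y - c| <= r -> `|x + s *: (y - x) - c| <= r.
Proof.
move=> /andP[s0 s1] xr yr.
have -> : x + s *: (y - x) - c = (1 - s) *: (x - c) + s *: (y - c).
  by apply/rowP => i; rewrite !mxE; ring.
apply: le_trans (ler_normD _ _) _.
rewrite !normrZ (ger0_norm s0) ger0_norm ?subr_ge0//.
have -> : r = (1 - s) * r + s * r by ring.
by rewrite lerD// ler_wpM2l// subr_ge0.
Qed.

Lemma strong_convexity c r a x y : hessian_ge c r a ->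
  `|x - c| <= r -> `|y - c| <= r ->
  g x + dot (gradient g x) (y - x) + a / 2 * dot (y - x) (y - x) <= g y.
Proof.
move=> Ha xr yr; have [s s01] := taylor2 x (y - x) dg dG.
rewrite (addrC x (y - x)) subrK => ->.
have /(Ha _ (y - x)) := ball_convex s01 xr yr; lra.
Qed.

Lemma smoothness c r L x y : 0 <= L -> hessian_entries_le c r L ->
  `|x - c| <= r -> `|y - c| <= r ->
  g y <= g x + dot (gradient g x) (y - x) + d%:R * L / 2 * dot (y - x) (y - x).
Proof.
move=> L0 HL xr yr; have [s s01] := taylor2 x (y - x) dg dG.
rewrite (addrC x (y - x)) subrK => ->.
have zr := ball_convex s01 xr yr.
have := quad_bound (y - x) L0 (fun i j => HL _ i j zr).
rewrite ler_norml => /andP[_]; lra.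
Qed.

Lemma gradient_le c r L x : 0 <= r -> 0 <= L -> hessian_entries_le c r L ->
  `|x - c| <= r -> `|gradient g x| <= `|gradient g c| + d%:R * (r * L).
Proof.
move=> r0 L0 HL xr; apply: normr_le_coord => [|j].
  by rewrite addr_ge0// mulr_ge0// mulr_ge0.
have [s s01] := gradient_mvt c (x - c) j dG.
rewrite (addrC c (x - c)) subrK => E.
have cr : `|c - c| <= r by rewrite subrr normr0.
have zr := ball_convex s01 cr xr.
rewrite -(subrK (gradient g c 0 j) (gradient g x 0 j)) E addrC.
apply: le_trans (ler_normD _ _) _; apply: lerD; first exact: normr_coord.
rewrite mxE; apply: le_trans (ler_norm_sum _ _ _) _.
have -> : d%:R * (r * L) = \sum_(i < d) r * L.
  by rewrite sumr_const card_ord mulr_natl.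
apply: ler_sum => i _; rewrite normrM ler_pM//; last exact: HL.
by apply: le_trans xr; exact: normr_coord.
Qed.

(** The reference point [c] replaces the minimizer of [g], which need not exist
    globally: this is the Polyak-Lojasiewicz inequality relative to [g c]. *)
Lemma polyak_lojasiewicz c r a x : 0 < a -> 0 <= r -> hessian_ge c r a ->
  `|x - c| <= r ->
  g x - g c <= dot (gradient g x) (gradient g x) / (2 * a).
Proof.
move=> a0 r0 Ha xr.
have cr : `|c - c| <= r by rewrite subrr normr0.
have := strong_convexity Ha xr cr.
have := dot_young (gradient g x) (c - x) a0; lra.
Qed.

Lemma quadratic_growth c r a x : 0 < a -> 0 <= r -> hessian_ge c r a ->
  `|x - c| <= r ->
  a / 4 * dot (x - c) (x - c) - dot (gradient g c) (gradient g c) / a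
    <= g x - g c.
Proof.
move=> a0 r0 Ha xr.
have cr : `|c - c| <= r by rewrite subrr normr0.
(* Half of the curvature absorbs the linear term. *)
have := strong_convexity Ha cr xr.
have := dot_young (gradient g c) (x - c) (divr_gt0 a0 (ltr0n R 2)).
have -> : 2 * (a / 2) = a by field.
have -> : a / 2 / 2 = a / 4 by field.
lra.
Qed.

(** Strong convexity on the unit ball with constant [a1] forces a slope of at least
    [a1 / 8] outside it, so the sublevel set is controlled by the curvature near
    [c] alone, however weak the convexity on the large ball of radius [r2]. *)
Lemma sublevel_bounded c (a1 r1 r2 a D : R) x :
  0 < a1 -> hessian_ge c 1 a1 ->
  dot (gradient g c) (gradient g c) <= a1 ^+ 2 / 8 ->
  1 <= r1 -> 8 * D <= a1 * r1 ->
  0 <= a -> hessian_ge c r2 a -> `|x - c| <= r2 -> g x - g c <= D ->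
  `|x - c| <= r1.
Proof.
move=> a10 H1 e1 r11 Dr a0 Ha xr2 gD; rewrite leNgt; apply/negP => r1x.
set s := `|x - c| in r1x xr2 *; have s1 : 1 < s by apply: le_lt_trans r1x.
have s0 : 0 < s by lra.
(* [y] is the point of the segment from [c] to [x] at distance one from [c]. *)
pose y := c + s^-1 *: (x - c).
have yc : y - c = s^-1 *: (x - c) by rewrite /y addrC addKr.
have y1 : `|y - c| = 1.
  by rewrite yc normrZ gtr0_norm ?invr_gt0// mulVf// gt_eqF.
have yr2 : `|y - c| <= r2 by rewrite y1; lra.
have cr2 : `|c - c| <= r2 by rewrite subrr normr0; lra.
have := strong_convexity Ha yr2 xr2; have := strong_convexity Ha yr2 cr2.
have -> : c - y = - (s^-1 *: (x - c)) by rewrite -yc opprB.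
have -> : x - y = (s - 1) *: (s^-1 *: (x - c)).
  rewrite -yc scalerBl scale1r yc scalerA mulfV ?gt_eqF// scale1r -yc.
  by rewrite opprB addrA subrK.
rewrite !(dotNr, dotZr, dotNl, dotZl) !(mulrN, opprK).
set p := dot (gradient g y) _; set q := dot (x - c) _.
have q0 : 0 <= q by exact: dot_ge0.
move=> A1 A2.
have B1 : g y + - (s^-1 * p) <= g c.
  apply: le_trans A1; rewrite lerDl !mulr_ge0// ?invr_ge0; lra.
have B2 : g y + (s - 1) * (s^-1 * p) <= g x.
  apply: le_trans A2; rewrite lerDl !mulr_ge0// ?invr_ge0; lra.
have B3 : s * (g y - g c) <= g x - g c.
  have : (s - 1) * (g y + - (s^-1 * p)) <= (s - 1) * g c.
    by rewrite ler_wpM2l//; lra.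
  move: (s^-1 * p) B2 => P; nra.
have := @quadratic_growth c 1 a1 y a10 ler01 H1.
rewrite y1 lexx => /(_ isT) G1.
have d1 : 1 <= dot (y - c) (y - c).
  by have := normr_sqr_le_dot (y - c); rewrite y1 expr1n.
have e2 : dot (gradient g c) (gradient g c) / a1 <= a1 / 8.
  by rewrite ler_pdivrMr//; move: e1; rewrite expr2; lra.
have G2 : a1 / 8 <= g y - g c by nra.
have : s * (a1 / 8) <= s * (g y - g c) by rewrite ler_wpM2l// ltW.
have : r1 * a1 < s * a1 by rewrite ltr_pM2r.
lra.
Qed.

Section Descent.
Variables (c theta0 : 'rV[R]_d) (a1 a L r1 r2 D beta : R) (K cgrad ceval B : nat).
Hypotheses (a1_gt0 : 0 < a1) (hess1 : hessian_ge c 1 a1).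
Hypothesis grad_c : dot (gradient g c) (gradient g c) <= a1 ^+ 2 / 8.
Hypotheses (r1_ge1 : 1 <= r1) (D_le : 8 * D <= a1 * r1) (D_ge0 : 0 <= D).
Hypotheses (theta0_r1 : `|theta0 - c| <= r1) (theta0_D : g theta0 - g c <= D).
Hypothesis grad_r1 : forall x, `|x - c| <= r1 -> `|gradient g x| <= r2 - r1.
Hypotheses (a_gt0 : 0 < a) (a_le1 : a <= 1) (hess2 : hessian_ge c r2 a).
Hypotheses (L_ge0 : 0 <= L) (hess2_le : hessian_entries_le c r2 L).
Hypotheses (beta_gt0 : 0 < beta) (beta_lt1 : beta < 1).
Hypothesis step_ok : beta ^+ K * (d%:R * L) <= 1.
Hypothesis ceval_gt0 : (0 < ceval)%N.

Let r1_ge0 : 0 <= r1. Proof. by apply: le_trans r1_ge1. Qed.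

Let r1_le_r2 : r1 <= r2.
Proof. by rewrite -subr_ge0 (le_trans _ (grad_r1 theta0_r1)). Qed.

Let r2_ge0 : 0 <= r2. Proof. exact: le_trans r1_le_r2. Qed.

Lemma step_in_r2 x (v : R) : `|x - c| <= r1 -> 0 <= v <= 1 ->
  `|x - v *: gradient g x - c| <= r2.
Proof.
move=> xr /andP[v0 v1]; rewrite addrAC; apply: le_trans (ler_normB _ _) _.
rewrite normrZ ger0_norm//.
have : v * `|gradient g x| <= `|gradient g x| by rewrite ler_piMl.
by have := grad_r1 xr; lra.
Qed.

Lemma beta_exp_itv k : 0 <= beta ^+ k <= 1.
Proof. by rewrite exprn_ge0 ?exprn_ile1// ltW. Qed.

Lemma sufficient_decrease x : `|x - c| <= r1 ->
  g (x - beta ^+ K *: gradient g x) <=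
  g x - beta ^+ K / 2 * enorm (gradient g x) ^+ 2.
Proof.
move=> xr; set v := beta ^+ K.
have xr2 := le_trans xr r1_le_r2.
have /(smoothness L_ge0 hess2_le xr2) := step_in_r2 xr (beta_exp_itv K).
rewrite -/v (addrC _ (- x)) addKr !(dotNr, dotZr, dotNl, dotZl) !(mulrN, opprK).
rewrite enorm_sqr; set q := dot _ _.
have vq0 : 0 <= v * q.
  by rewrite mulr_ge0 ?dot_ge0//; have /andP[] := beta_exp_itv K.
have := ler_wpM2l vq0 step_ok; rewrite -/v; move: (d%:R * L) => l; nra.
Qed.

(** The step [beta ^+ K] always passes the test, so only the budget can stop the
    search before an accepted step, and it tries no smaller step than this one. *)
Lemma line_search_spec x b : `|x - c| <= r1 -> (ceval <= b)%N ->
  exists k, [/\ (k <= K)%N, (k.+1 * ceval <= b)%N &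
    line_search g ceval beta x (g x) (gradient g x) b =
    (beta ^+ k, g (x - beta ^+ k *: gradient g x), b - k.+1 * ceval)%N].
Proof.
move=> xr cb; pose I (s : R * R * nat) := exists k, [/\ (k <= K)%N,
  (k.+1 * ceval <= b)%N &
  s = (beta ^+ k, g (x - beta ^+ k *: gradient g x), b - k.+1 * ceval)%N].
apply: (@while_invariant _ I).
  move=> _ [k [kK kb ->]] /= /andP[gk ck].
  have k_ltK : (k < K)%N.
    rewrite ltn_neqAle kK andbT; apply/eqP => kE.
    by move: gk; rewrite kE ltNge sufficient_decrease.
  have k2b : (k.+2 * ceval <= b)%N.
    by rewrite mulSn; clear -ck kb; lia.
  by exists k.+1; split => //; rewrite -exprS -subnDA addnC -mulSn.
by exists 0; rewrite mul1n expr0 scale1r.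
Qed.

Let W := (cgrad + K.+1 * ceval)%N.
Let kappa := beta ^+ K * a.

(** Here [t] counts the accepted steps and [W] bounds the cost of one step, as of the
    initialization. The last summand of the budget pays for a line search that ran
    out of budget; nothing is then left for a further one. The stored value is
    claimed correct only when the loop can still be entered, because the initial one
    is a placeholder if it was not affordable. *)
Definition gd_invariant (s : @gd_state R d) := exists t : nat,
  [/\ `|gd_iterate s - c| <= r1,
      (1 + t%:R * kappa) * (g (gd_iterate s) - g c) <= D,
      (B <= gd_budget s + t.+1 * W + (if (gd_budget s < ceval)%N then W else 0))%N
    & if gd_grad s is Some G
      then G = gradient g (gd_iterate s) /\
           ((ceval <= gd_budget s)%N -> gd_value s = g (gd_iterate s))
      else (gd_budget s < cgrad)%N].

Let kappa_gt0 : 0 < kappa. Proof. by rewrite mulr_gt0// exprn_gt0. Qed.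

Let kappa_le1 : kappa <= 1.
Proof.
have /andP[b0 b1] := beta_exp_itv K.
by rewrite -(mulr1 1) ler_pM// ltW.
Qed.

Lemma gd_invariant_init : gd_invariant (gd_init g cgrad ceval theta0 B).
Proof.
rewrite /gd_init; exists 0%N.
have cW : (cgrad + ceval <= W)%N by rewrite leq_add2l mulSn leq_addr.
case: ifPn => [cB|]; last by rewrite -ltnNge /= mul0r addr0 mul1r => cB; split => //; clear -cB cW; clearbody W; lia.
case: ifPn => [eB|]; rewrite /= mul0r addr0 mul1r mul1n.
  split => //; clear -cW cB eB; clearbody W; lia.
rewrite -ltnNge => eB; split => //; first by rewrite eB; clear -cW eB cB; clearbody W; lia.
by split => //; rewrite leqNgt eB.
Qed.

Lemma gd_invariant_body s : gd_invariant s -> gd_test ceval 0 s ->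
  gd_invariant (gd_body g cgrad ceval beta s).
Proof.
case: s => theta v0 [G|] b [t]; rewrite /gd_test //= => -[xr del bud [-> val]].
move=> /andP[G0 cb]; rewrite /gd_body /= (val cb).
have [k [kK kb Ek]] := line_search_spec xr cb; rewrite Ek.
rewrite ltnNge cb addn0 in bud.
have kW : (k.+1 * ceval + cgrad <= W)%N.
  by rewrite addnC leq_add2l leq_mul2r ltnS kK orbT.
have xr2 := le_trans xr r1_le_r2.
case: ifPn => [acc|]; last first.
  rewrite -ltNge => rej.
  have := line_search_exit g beta theta (g theta) (gradient g theta) b ceval_gt0.
  rewrite Ek /= rej /= -ltnNge => cb'.
  exists t; rewrite /= cb'; split => //.
  rewrite -addnA (addnC (t.+1 * W)%N); apply: leq_spend bud _.
  exact: leq_trans (leq_addr _ _) kW.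
set theta' := theta - _.
have /andP[bk0 bk1] := beta_exp_itv k.
have bkK : beta ^+ K <= beta ^+ k by apply: ler_wiXn2l => //; exact: ltW.
have GG0 : 0 <= dot (gradient g theta) (gradient g theta) by exact: dot_ge0.
have dec : g theta' - g c <= (1 - kappa) * (g theta - g c).
  have PL := polyak_lojasiewicz a_gt0 r2_ge0 hess2 xr2.
  have : kappa * (g theta - g c) <= beta ^+ k / 2 * enorm (gradient g theta) ^+ 2.
    rewrite enorm_sqr /kappa -mulrA.
    apply: (@le_trans _ _ (beta ^+ K * (a * (dot (gradient g theta) (gradient g theta) / (2 * a))))).
      apply: ler_wpM2l; first by have /andP[] := beta_exp_itv K.
      by apply: ler_wpM2l => //; exact: ltW.
    have -> : a * (dot (gradient g theta) (gradient g theta) / (2 * a)) =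
       dot (gradient g theta) (gradient g theta) / 2 by field; rewrite gt_eqF.
    have := ler_wpM2r GG0 bkK; lra.
  by move: acc; lra.
have kappa01 : 0 < kappa <= 1 by rewrite kappa_gt0 kappa_le1.
have [mono del'] := harmonic_decay kappa01 (ler0n R t) D_ge0 del dec.
have xr' : `|theta' - c| <= r1.
  apply: (sublevel_bounded a1_gt0 hess1 grad_c r1_ge1 D_le (ltW a_gt0) hess2) => //.
  by apply: step_in_r2 => //; rewrite bk0.
rewrite natr1 in del'.
case: ifPn => gb; exists t.+1; split => //=.
- by rewrite mulSn -subnDA; apply: leq_trans (leq_spend bud kW) (leq_addr _ _).
- rewrite mulSn; apply: leq_trans _ (leq_addr _ _); apply: leq_spend bud _.
  exact: leq_trans (leq_addr _ _) kW.
- by rewrite ltnNge.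
Qed.

(** Either the loop stopped at an exact critical point, where [g - g c] is already
    nonpositive, or it spent the whole budget, hence made at least [B / W - 3] steps. *)
Lemma gd_run_dist : (0 < B)%N ->
  enorm (gd_iterate (gd_run g cgrad ceval 0 beta theta0 B) - c) ^+ 2 <= 4 / a *
    (3 / kappa * D * (W%:R / B%:R) + dot (gradient g c) (gradient g c) / a).
Proof.
move=> B0.
have : gd_invariant (gd_run g cgrad ceval 0 beta theta0 B).
  by apply: while_invariant; [exact: gd_invariant_body|exact: gd_invariant_init].
have := gd_exit g cgrad 0 beta theta0 B ceval_gt0.
case: gd_run => x v G b ex [t] /= [xr del bud grad].
have xr2 := le_trans xr r1_le_r2.
have B0' : 0 < B%:R :> R by rewrite ltr0n.
have W0 : 0 <= W%:R :> R by [].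
suff key : g x - g c <= 3 / kappa * D * (W%:R / B%:R).
  have := quadratic_growth a_gt0 r2_ge0 hess2 xr2.
  rewrite enorm_sqr => QG.
  have -> : dot (x - c) (x - c) = 4 / a * (a / 4 * dot (x - c) (x - c)).
    by field; rewrite gt_eqF.
  by rewrite ler_wpM2l ?divr_ge0 ?(ltW a_gt0)//; lra.
have rhs0 : 0 <= 3 / kappa * D * (W%:R / B%:R).
  apply: mulr_ge0; last exact: divr_ge0.
  by apply: mulr_ge0 => //; apply: divr_ge0 => //; exact: ltW.
have [dneg|dpos] := leP (g x - g c) 0; first exact: le_trans rhs0.
have {bud} : (B <= t.+3 * W)%N.
  have cW : (ceval <= W)%N by rewrite /W mulSn addnCA leq_addr.
  case: G grad ex => [G [-> _]|]; rewrite /gd_test /=; last first.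
    have : (cgrad <= W)%N by rewrite leq_addr.
    move=> gW bg _; move: bud; case: ifP => _; rewrite !mulSn;
      by clear -gW bg; clearbody W; lia.
  rewrite negb_and -leNgt -ltnNge => /orP[G0|bc]; last first.
    by move: bud; rewrite bc !mulSn; clear -bc cW; clearbody W; lia.
  have G0' : enorm (gradient g x) = 0.
    by apply/eqP; rewrite eq_le G0 enorm_ge0.
  have := polyak_lojasiewicz a_gt0 r2_ge0 hess2 xr2.
  by rewrite -enorm_sqr G0' expr0n mul0r leNgt dpos.
rewrite -(ler_nat R) natrM => bud.
rewrite mulrA ler_pdivlMr//.
have t3 : t.+3%:R <= 3 / kappa * (1 + t%:R * kappa).
  have -> : t.+3%:R = t%:R + 3 :> R by rewrite -addn3 natrD.
  have -> : 3 / kappa * (1 + t%:R * kappa) = 3 / kappa + 3 * t%:R.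
    by field; rewrite gt_eqF.
  have : 3 <= 3 / kappa by rewrite ler_pdivlMr// ler_piMr.
  have : 0 <= t%:R :> R by [].
  by move: (t%:R) (3 / kappa) => T q; lra.
apply: (@le_trans _ _ ((g x - g c) * (t.+3%:R * W%:R))).
  by rewrite ler_wpM2l// ltW.
apply: (@le_trans _ _ ((g x - g c) * (3 / kappa * (1 + t%:R * kappa) * W%:R))).
  by rewrite ler_wpM2l ?(ltW dpos)// ler_wpM2r.
have k30 : 0 <= 3 / kappa by rewrite divr_ge0// ltW.
have := ler_wpM2r W0 (ler_wpM2l k30 del).
by rewrite -!mulrA; move: (3 / kappa) => q; nra.
Qed.

End Descent.
End Deterministic.

(** * Compact balls and rational points *)

Section Space.
Context {R : realType} {d : nat}.
Implicit Types x y c : 'rV[R]_d.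

Lemma compact_ball_le c (r : R) : compact [set x : 'rV[R]_d | `|x - c| <= r].
Proof.
rewrite (_ : [set x | _] = closed_ball_ Num.norm c r); last first.
  by apply/seteqP; split => x /=; rewrite distrC.
apply: bounded_closed_compact; last exact: closed_closed_ball_.
exists (`|c| + r); split; first exact: num_real.
move=> M cM x /= xr; apply: le_trans (ltW cM).
rewrite -(subrK c x) addrC; apply: le_trans (ler_normD _ _) _.
by rewrite lerD2l distrC.
Qed.

Lemma finite_net c (r e : R) : 0 < e ->
  exists s : seq 'rV[R]_d, forall x, `|x - c| <= r ->
    exists y, [/\ y \in s, `|y - c| <= r & `|x - y| < e].
Proof.
move=> e0; have := @compact_ball_le c r; rewrite compact_cover.
move=> /(_ _ [set x | `|x - c| <= r] (fun y => [set x | `|x - y| < e])).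
have op y : open [set x : 'rV[R]_d | `|x - y| < e].
  rewrite (_ : [set x | _] = ball y e); first exact: ball_open.
  by rewrite -ball_normE; apply/seteqP; split => x /=; rewrite distrC.
case=> [y _ //|x /= xr|D' D'r cov]; first by exists x => //=; rewrite subrr normr0.
exists D' => x /cov [y /= yD xy]; exists y; split => //.
by have := D'r _ yD; rewrite inE.
Qed.

Lemma rat_point_near x (e : R) : 0 < e ->
  exists q : 'rV[rat]_d, `|x - map_mx ratr q| < e.
Proof.
move=> e0; have e20 : 0 < e / 2 by rewrite divr_gt0.
have /choice[q Hq] : forall j, exists q : rat, `|x 0 j - ratr q| < e / 2.
  move=> j; have : x 0 j - e / 2 < x 0 j + e / 2 by rewrite ltrD2l gtrN.
  move=> /rat_in_itvoo[q]; rewrite in_itv/= => /andP[q1 q2].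
  by exists q; rewrite distrC ltr_distl q1 q2.
exists (\row_j q j); apply: (@le_lt_trans _ _ (e / 2)).
  by apply: normr_le_coord => [|j]; rewrite ?mxE; apply: ltW.
by rewrite ltr_pdivrMr// ltr_pMr// ltr1n.
Qed.

End Space.

(** * Measurability of the output of gradient descent *)

(** The number of rounds of a loop is random; on each of its countably many values
    the loop is an iteration of fixed length. *)
Lemma measurable_fun_nat_index d1 d2 (T : measurableType d1) (T' : measurableType d2)
    (b : T -> nat) (F : nat -> T -> T') :
  measurable_fun [set: T] b -> (forall k, measurable_fun [set: T] (F k)) ->
  measurable_fun [set: T] (fun t => F (b t) t).
Proof.
move=> mb mF _ A mA; rewrite setTI.
rewrite (_ : _ @^-1` _ = \bigcup_k (b @^-1` [set k] `&` F k @^-1` A)).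
  apply: bigcupT_measurable => k; apply: measurableI.
    by rewrite -[X in measurable X]setTI; exact: mb.
  by rewrite -[X in measurable X]setTI; exact: mF.
by apply/seteqP; split => [t /= ? //|t /= [k _ [/= <-]]//]; exists (b t).
Qed.

Lemma measurable_fun_from_nat d2 (T' : measurableType d2) (F : nat -> T') :
  measurable_fun [set: nat] F.
Proof. by []. Qed.

Section MeasurableVectors.
Context {dT} {T : measurableType dT} {R : realType} {d : nat}.
Implicit Types th : T -> 'rV[R]_d.

Definition measurable_vec th := forall k, measurable_fun [set: T] (fun t => th t 0 k).

(** Every open set is a union of boxes with rational data, and the preimage of a box
    is measurable coordinate by coordinate. *)
Lemma measurable_vec_borel th : measurable_vec th ->
  measurable_fun [set: T] (th : T -> borel 'rV[R]_d).
Proof.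
move=> mth; apply: (@measurability _ _ T (borel 'rV[R]_d) setT th (@open 'rV[R]_d)) => // _ [U oU <-].
rewrite setTI.
pose box (i : 'rV[rat]_d * nat) := [set x : 'rV[R]_d |
  forall j, `|x 0 j - ratr (i.1 0 j)| < i.2.+1%:R^-1].
rewrite (_ : th @^-1` U =
    \bigcup_i (if `[< box i `<=` U >] then th @^-1` box i else set0)).
  apply: countable_bigcupT_measurable => [|i]; first exact: countableP.
  case: ifP => // _.
  rewrite (_ : th @^-1` box i = \bigcap_(j in [set: 'I_d])
      [set t | `|th t 0 j - ratr (i.1 0 j)| < i.2.+1%:R^-1]); last first.
    by apply/seteqP; split => t H j //; [move=> _|]; exact: H.
  apply: fin_bigcap_measurable => [|j _]; first exact: finite_finset.
  rewrite -[X in measurable X]setTI.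
  rewrite (_ : [set t | _] = (fun t => `|th t 0 j - ratr (i.1 0 j)|) @^-1` `]-oo, i.2.+1%:R^-1[).
    have mf : measurable_fun [set: T] (fun t => `|th t 0 j - ratr (i.1 0 j)|).
      by apply: measurableT_comp => //; exact: measurable_funB.
    by apply: mf => //; exact: measurable_itv.
  by apply/seteqP; split => t /=; rewrite in_itv.
apply/seteqP; split => [t /= Ut|t [i _] /=]; last first.
  by case: ifPn => // /asboolP bU /bU.
have /nbhs_ballP[e /= e0 eU] : nbhs (th t) U by exact: open_nbhs_nbhs.
have [k ke] : exists k : nat, k.+1%:R^-1 < e / 2.
  by have [k _ H] := near_infty_natSinv_lt (PosNum (divr_gt0 e0 (ltr0n R 2)));
    exists k; exact: (H k (leqnn _)).
have k0 : 0 < k.+1%:R^-1 :> R by rewrite invr_gt0.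
have [q Hq] := rat_point_near (th t) k0.
have qj j : `|th t 0 j - ratr (q 0 j)| < k.+1%:R^-1.
  by apply: le_lt_trans Hq; have := normr_coord (th t - map_mx ratr q) j; rewrite !mxE.
exists (q, k) => //=.
case: ifPn => [_|]; first exact: qj.
move=> /asboolPn nb; exfalso; apply: nb => y /= yb; apply: eU.
rewrite -ball_normE/=; apply: (@le_lt_trans _ _ (k.+1%:R^-1 + k.+1%:R^-1)); last first.
  by rewrite [ltRHS](splitr e) ltrD.
apply: normr_le_coord => [|j]; first by rewrite addr_ge0// invr_ge0.
rewrite !mxE -(subrKA (ratr (q 0 j))); apply: le_trans (ler_normD _ _) _.
by apply: lerD; apply: ltW; [exact: qj|rewrite distrC; exact: yb].
Qed.

Lemma measurable_vecD th th' : measurable_vec th -> measurable_vec th' ->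
  measurable_vec (fun t => th t + th' t).
Proof.
move=> m m' k.
have -> : (fun t => (th t + th' t) 0 k) = (fun t => th t 0 k + th' t 0 k).
  by apply/funext => t; rewrite mxE.
exact: measurable_funD.
Qed.

Lemma measurable_vecZ (v : T -> R) th : measurable_fun [set: T] v ->
  measurable_vec th -> measurable_vec (fun t => v t *: th t).
Proof.
move=> m m' k.
have -> : (fun t => (v t *: th t) 0 k) = (fun t => v t * th t 0 k).
  by apply/funext => t; rewrite mxE.
exact: measurable_funM.
Qed.

Lemma measurable_vec_cst (x : 'rV[R]_d) : measurable_vec (fun=> x).
Proof. by move=> k; exact: measurable_cst. Qed.

Lemma measurable_vecB th th' : measurable_vec th -> measurable_vec th' ->
  measurable_vec (fun t => th t - th' t).
Proof.
move=> m m'; have -> : (fun t => th t - th' t) = (fun t => th t + -1 *: th' t).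
  by apply/funext => t; rewrite scaleN1r.
by apply: measurable_vecD => //; apply: measurable_vecZ.
Qed.

Lemma measurable_enorm th : measurable_vec th ->
  measurable_fun [set: T] (fun t => enorm (th t)).
Proof.
move=> m; apply: (@measurableT_comp _ _ _ _ _ _ (@Num.sqrt R)).
  by apply: continuous_measurable_fun; exact: sqrt_continuous.
by apply: measurable_sum => i; apply: measurable_funX.
Qed.

(** Measurability of [q (th t) t] for every random point [th]: unlike measurability
    on the product space, it passes to partial derivatives by a bare limit of
    difference quotients. *)
Definition measurable_at_points (q : 'rV[R]_d -> T -> R) :=
  forall th, measurable_vec th -> measurable_fun [set: T] (fun t => q (th t) t).

Lemma measurable_gradient q : measurable_at_points q ->
  (forall t p, differentiable (q ^~ t) p) ->
  forall k, measurable_at_points (fun p t => gradient (q ^~ t) p 0 k).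
Proof.
move=> mq dq k th mth.
pose e : 'rV[R]_d := delta_mx 0 k.
pose h (m : nat) t := m.+1%:R * (q (m.+1%:R^-1 *: e + th t) t - q (th t) t).
apply: (@measurable_fun_cvg _ _ _ _ h) => [m|t _].
  apply: measurable_funM => //; apply: measurable_funB; last exact: mq.
  by apply: mq; apply: measurable_vecD => //; exact: measurable_vec_cst.
rewrite mxE -deriveE//.
have : derivable (q ^~ t) (th t) e by exact: diff_derivable.
have inv0 : (fun m : nat => m.+1%:R^-1 : R) @ \oo --> 0^'.
  move=> A [r /= r0 Ar].
  have := near_infty_natSinv_lt (PosNum r0); apply: filterS => m /= mr.
  apply: Ar; last by rewrite /= invr_eq0 pnatr_eq0.
  by rewrite /= sub0r normrN gtr0_norm ?invr_gt0.
rewrite /derivable /derive; set g := (fun h : R => _) => dg.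
have -> : h ^~ t = g \o (fun m : nat => m.+1%:R^-1).
  by apply/funext => m; rewrite /h /g /= invrK.
exact: (cvg_comp _ _ inv0 dg).
Qed.

Lemma measurable_hessian q : measurable_at_points q ->
  (forall t p, differentiable (q ^~ t) p) ->
  (forall t p, differentiable (gradient (q ^~ t)) p) ->
  forall k l, measurable_at_points (fun p t => hessian (q ^~ t) p k l).
Proof.
move=> mq dq dG k l.
have dc t p : differentiable (fun p => gradient (q ^~ t) p 0 l) p.
  exact: (differentiable_comp (dG t p) (differentiable_coord _ _ _)).
(* An entry of the Hessian is an entry of the gradient of a partial derivative. *)
have -> : (fun p t => hessian (q ^~ t) p k l) =
    (fun p t => gradient (fun p => gradient (q ^~ t) p 0 l) p 0 k).
  apply/funext => p; apply/funext => t.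
  rewrite hessianE mxE -deriveE// -deriveE// derive_mx ?mxE//.
  exact: diff_derivable.
exact: (measurable_gradient (measurable_gradient mq dq l) dc).
Qed.

Lemma measurable_vec_gradient q th : measurable_at_points q ->
  (forall t p, differentiable (q ^~ t) p) -> measurable_vec th ->
  measurable_vec (fun t => gradient (q ^~ t) (th t)).
Proof. by move=> mq dq mth k; exact: measurable_gradient. Qed.

Lemma measurable_while (S : Type) (M : (T -> S) -> Prop) (test : T -> S -> bool)
    (body : T -> S -> S) :
  (forall (c : T -> bool) s s', measurable_fun [set: T] c -> M s -> M s' ->
    M (fun t => if c t then s t else s' t)) ->
  (forall s, M s -> measurable_fun [set: T] (fun t => test t (s t))) ->
  (forall s, M s -> M (fun t => body t (s t))) ->
  forall k s, M s -> M (fun t => while k (test t) (body t) (s t)).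
Proof.
move=> Mif mt mb; elim=> [//|k IHk] s Ms /=.
by apply: Mif; [exact: mt|exact/(IHk (fun t => body t (s t)))/mb|].
Qed.

End MeasurableVectors.

Section MeasurableDescent.
Context {dT} {T : measurableType dT} {R : realType} {d : nat}.
Variables (q : 'rV[R]_d -> T -> R) (cgrad ceval : nat) (tau beta : R).
Hypothesis mq : measurable_at_points q.
Hypothesis dq : forall t p, differentiable (q ^~ t) p.

Lemma measurable_fun_line_search (th G : T -> 'rV[R]_d) (g : T -> R) (b : T -> nat) :
  measurable_vec th -> measurable_vec G -> measurable_fun [set: T] g ->
  measurable_fun [set: T] b ->
  measurable_fun [set: T]
    (fun t => line_search (q ^~ t) ceval beta (th t) (g t) (G t) (b t)).
Proof.
move=> mth mG mg mb.
have mtrial (v : T -> R) : measurable_fun [set: T] v ->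
    measurable_fun [set: T] (fun t => q (th t - v t *: G t) t).
  by move=> mv; apply: mq; apply: measurable_vecB => //; exact: measurable_vecZ.
have mtrial1 : measurable_fun [set: T] (fun t => q (th t - G t) t).
  by apply: mq; exact: measurable_vecB.
have msub (c : T -> nat) : measurable_fun [set: T] c ->
    measurable_fun [set: T] (fun t => c t - ceval)%N.
  exact: (measurableT_comp (measurable_fun_from_nat (subn ^~ ceval))).
apply: (@measurable_fun_nat_index _ _ _ _ b (fun k t => while k
  (ls_test ceval (g t) (G t)) (ls_body (q ^~ t) ceval beta (th t) (G t))
  (1, q (th t - G t) t, (b t - ceval)%N))) => // k.
apply: (@measurable_while _ T _ (fun s => measurable_fun [set: T] s)).
- by move=> c s s' mc ms ms'; exact: measurable_fun_ifT.
- move=> s ms; rewrite (_ : (fun t => _) = (fun t =>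
    (g t - (s t).1.1 / 2 * enorm (G t) ^+ 2 < (s t).1.2) && (ceval <= (s t).2)%N)).
    have m1 := measurableT_comp measurable_fst ms.
    have m2 := measurableT_comp measurable_snd ms.
    have m11 := measurableT_comp measurable_fst m1.
    have m12 := measurableT_comp measurable_snd m1.
    apply: measurable_and.
      apply: measurable_fun_ltr => //; apply: measurable_funB => //.
      apply: measurable_funM; first exact: measurable_funM.
      by apply: measurable_funX; exact: measurable_enorm.
    exact: (measurableT_comp (measurable_fun_from_nat (leq ceval)) m2).
  by apply/funext => t; case: (s t) => [[]].
- move=> s ms; rewrite (_ : (fun t => _) = (fun t => (beta * (s t).1.1,
    q (th t - (beta * (s t).1.1) *: G t) t, ((s t).2 - ceval)%N))).
    have m1 := measurableT_comp measurable_fst ms.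
    have m2 := measurableT_comp measurable_snd ms.
    have m11 := measurableT_comp measurable_fst m1.
    have mb11 : measurable_fun [set: T] (fun t => beta * (s t).1.1).
      exact: measurable_funM.
    apply: measurable_fun_pair; last exact: msub.
    by apply: measurable_fun_pair => //; exact: mtrial.
  by apply/funext => t; case: (s t) => [[]].
- apply: measurable_fun_pair; last exact: msub.
  exact: measurable_fun_pair.
Qed.

(** States carry no sigma-algebra of their own; the optional gradient is described by
    its presence and by its value, [0] when absent. *)
Definition measurable_state (s : T -> @gd_state R d) :=
  [/\ measurable_vec (fun t => gd_iterate (s t)),
      measurable_fun [set: T] (fun t => gd_value (s t)),
      measurable_fun [set: T] (fun t => gd_grad (s t) : bool),
      measurable_vec (fun t => odflt 0 (gd_grad (s t)))
    & measurable_fun [set: T] (fun t => gd_budget (s t))].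

Lemma measurable_state_if (c : T -> bool) s s' :
  measurable_fun [set: T] c -> measurable_state s -> measurable_state s' ->
  measurable_state (fun t => if c t then s t else s' t).
Proof.
move=> mc [i v g gg b] [i' v' g' gg' b']; split.
- move=> k; rewrite (_ : (fun t => _) =
    (fun t => if c t then gd_iterate (s t) 0 k else gd_iterate (s' t) 0 k)).
    exact: measurable_fun_ifT.
  by apply/funext => t; case: ifP.
- rewrite (_ : (fun t => _) =
    (fun t => if c t then gd_value (s t) else gd_value (s' t))).
    exact: measurable_fun_ifT.
  by apply/funext => t; case: ifP.
- rewrite (_ : (fun t => _) =
    (fun t => if c t then gd_grad (s t) : bool else gd_grad (s' t))).
    exact: measurable_fun_ifT.
  by apply/funext => t; case: ifP.
- move=> k; rewrite (_ : (fun t => _) = (fun t =>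
    if c t then odflt 0 (gd_grad (s t)) 0 k else odflt 0 (gd_grad (s' t)) 0 k)).
    exact: measurable_fun_ifT.
  by apply/funext => t; case: ifP.
- rewrite (_ : (fun t => _) =
    (fun t => if c t then gd_budget (s t) else gd_budget (s' t))).
    exact: measurable_fun_ifT.
  by apply/funext => t; case: ifP.
Qed.

Lemma measurable_state_none (th : T -> 'rV[R]_d) (g : T -> R) (b : T -> nat) :
  measurable_vec th -> measurable_fun [set: T] g -> measurable_fun [set: T] b ->
  measurable_state (fun t => GDState (th t) (g t) None (b t)).
Proof. by move=> mth mg mb; split => //; exact: measurable_vec_cst. Qed.

Lemma measurable_state_some (th G : T -> 'rV[R]_d) (g : T -> R) (b : T -> nat) :
  measurable_vec th -> measurable_fun [set: T] g -> measurable_vec G ->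
  measurable_fun [set: T] b ->
  measurable_state (fun t => GDState (th t) (g t) (Some (G t)) (b t)).
Proof. by []. Qed.

Lemma measurable_gd_body s : measurable_state s ->
  measurable_state (fun t => gd_body (q ^~ t) cgrad ceval beta (s t)).
Proof.
move=> ms; have [mi mv mg mgg mb] := ms.
pose G t := odflt 0 (gd_grad (s t)).
pose ls t := line_search (q ^~ t) ceval beta (gd_iterate (s t)) (gd_value (s t))
  (G t) (gd_budget (s t)).
have mls : measurable_fun [set: T] ls by exact: measurable_fun_line_search.
have m1 := measurableT_comp measurable_fst mls.
have m2 := measurableT_comp measurable_snd mls.
have m11 := measurableT_comp measurable_fst m1.
have m12 := measurableT_comp measurable_snd m1.
pose th' t := gd_iterate (s t) - (ls t).1.1 *: G t.
have mth' : measurable_vec th'.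
  by apply: measurable_vecB => //; exact: measurable_vecZ.
rewrite (_ : (fun t => _) = (fun t => if gd_grad (s t) : bool then
   (if (ls t).1.2 <= gd_value (s t) - (ls t).1.1 / 2 * enorm (G t) ^+ 2 then
     (if (cgrad <= (ls t).2)%N then
        GDState (th' t) (ls t).1.2 (Some (gradient (q ^~ t) (th' t)))
          ((ls t).2 - cgrad)%N
      else GDState (th' t) (ls t).1.2 None (ls t).2)
    else GDState (gd_iterate (s t)) (gd_value (s t)) (Some (G t)) (ls t).2)
  else s t)).
  apply: measurable_state_if => //; apply: measurable_state_if.
  - apply: measurable_fun_ler => //; apply: measurable_funB => //.
    apply: measurable_funM; first exact: measurable_funM.
    by apply: measurable_funX; exact: measurable_enorm.
  - apply: measurable_state_if.
    + exact: (measurableT_comp (measurable_fun_from_nat (leq cgrad)) m2).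
    + apply: measurable_state_some => //; first exact: measurable_vec_gradient.
      exact: (measurableT_comp (measurable_fun_from_nat (subn ^~ cgrad)) m2).
    + exact: measurable_state_none.
  - exact: measurable_state_some.
apply/funext => t; rewrite /gd_body /th' /ls /G.
case: (s t) => th g [G'|] b //=.
by case: line_search => [[v g'] b'].
Qed.

Lemma measurable_gd_test s : measurable_state s ->
  measurable_fun [set: T] (fun t => gd_test ceval tau (s t)).
Proof.
move=> [mi mv mg mgg mb].
rewrite (_ : (fun t => _) = (fun t => [&& (gd_grad (s t) : bool),
  tau < enorm (odflt 0 (gd_grad (s t))) & (ceval <= gd_budget (s t))%N])).
  apply: measurable_and => //; apply: measurable_and.
    by apply: measurable_fun_ltr => //; exact: measurable_enorm.
  exact: (measurableT_comp (measurable_fun_from_nat (leq ceval)) mb).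
by apply/funext => t; rewrite /gd_test; case: gd_grad.
Qed.

Lemma measurable_gd_init theta0 B :
  measurable_state (fun t => gd_init (q ^~ t) cgrad ceval theta0 B).
Proof.
have mc := @measurable_vec_cst _ T R d theta0.
have mG : measurable_vec (fun t => gradient (q ^~ t) theta0).
  exact: measurable_vec_gradient.
rewrite /gd_init; case: (cgrad <= B)%N; last exact: measurable_state_none.
case: (ceval <= B - cgrad)%N; last exact: measurable_state_some.
by apply: measurable_state_some => //; exact: (mq mc).
Qed.

Lemma measurable_gd_run theta0 B :
  measurable_vec (fun t => gd_iterate (gd_run (q ^~ t) cgrad ceval tau beta theta0 B)).
Proof.
have mi := measurable_gd_init theta0 B; have [_ _ _ _ mb] := mi => l.
apply: (@measurable_fun_nat_index _ _ _ _ _ (fun k t => gd_iterate (while k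
  (gd_test ceval tau) (gd_body (q ^~ t) cgrad ceval beta)
  (gd_init (q ^~ t) cgrad ceval theta0 B)) 0 l) mb) => k.
have [] // : measurable_state (fun t => while k
  (gd_test ceval tau) (gd_body (q ^~ t) cgrad ceval beta)
  (gd_init (q ^~ t) cgrad ceval theta0 B)).
apply: (@measurable_while _ _ _ measurable_state (fun=> gd_test ceval tau)) mi.
- exact: measurable_state_if.
- exact: measurable_gd_test.
- exact: measurable_gd_body.
Qed.

End MeasurableDescent.

(** * Expectations, and the law of large numbers *)

Section Expectation.
Context {dT} {T : measurableType dT} {R : realType} (P : probability T R).
Implicit Types X Y : T -> R.

Definition integrableR X := P.-integrable [set: T] (EFin \o X).

Definition Ex X : R := Rintegral P [set: T] X.

Lemma integrableR_measurable X : integrableR X -> measurable_fun [set: T] X.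
Proof. by move=> /measurable_int/measurable_EFinP. Qed.

Lemma integrableR_cst c : integrableR (fun=> c).
Proof. exact: finite_measure_integrable_cst. Qed.

Lemma integrableRD X Y : integrableR X -> integrableR Y ->
  integrableR (fun w => X w + Y w).
Proof. exact: integrableD. Qed.

Lemma integrableRB X Y : integrableR X -> integrableR Y ->
  integrableR (fun w => X w - Y w).
Proof. exact: integrableB. Qed.

Lemma integrableRZ c X : integrableR X -> integrableR (fun w => c * X w).
Proof. exact: integrableZl. Qed.

Lemma integrableR_norm X : integrableR X -> integrableR (fun w => `|X w|).
Proof. exact: integrable_norm. Qed.

Lemma integrableR_sum (I : Type) (s : seq I) (X : I -> T -> R) :
  (forall i, integrableR (X i)) -> integrableR (fun w => \sum_(i <- s) X i w).
Proof.
move=> iX; have := @integrable_sum _ _ _ P _ (@measurableT _ T) _ s xpredT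
  (fun i => EFin \o X i) (fun i _ => iX i).
by apply: eq_integrable => // w _; rewrite /= sumEFin.
Qed.

Lemma integrableR_le X Y : measurable_fun [set: T] X ->
  (forall w, `|X w| <= Y w) -> integrableR Y -> integrableR X.
Proof.
move=> mX XY; apply: le_integrable => //; first exact/measurable_EFinP.
by move=> w _; rewrite /= lee_fin (le_trans (XY w))// ler_norm.
Qed.

Lemma integrableR_bounded X (c : R) : measurable_fun [set: T] X ->
  (forall w, `|X w| <= c) -> integrableR X.
Proof. by move=> mX Xc; exact: integrableR_le (integrableR_cst c). Qed.

Lemma Ex_cst c : Ex (fun=> c) = c.
Proof. by rewrite /Ex /Rintegral integral_cst//= probability_setT mule1. Qed.

Lemma ExD X Y : integrableR X -> integrableR Y ->
  Ex (fun w => X w + Y w) = Ex X + Ex Y.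
Proof. exact: RintegralD. Qed.

Lemma ExB X Y : integrableR X -> integrableR Y ->
  Ex (fun w => X w - Y w) = Ex X - Ex Y.
Proof. exact: RintegralB. Qed.

Lemma ExZ c X : integrableR X -> Ex (fun w => c * X w) = c * Ex X.
Proof. exact: RintegralZl. Qed.

Lemma Ex_sum (I : Type) (s : seq I) (X : I -> T -> R) :
  (forall i, integrableR (X i)) ->
  Ex (fun w => \sum_(i <- s) X i w) = \sum_(i <- s) Ex (X i).
Proof.
move=> iX; elim: s => [|i s IHs].
  rewrite big_nil -[RHS](Ex_cst 0).
  by apply: eq_Rintegral => w _; rewrite big_nil.
rewrite big_cons -IHs -ExD//; last exact: integrableR_sum.
by apply: eq_Rintegral => w _; rewrite big_cons.
Qed.

Lemma le_Ex X Y : integrableR X -> integrableR Y -> (forall w, X w <= Y w) ->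
  Ex X <= Ex Y.
Proof. by move=> iX iY XY; exact: le_Rintegral. Qed.

Lemma Ex_ge0 X : (forall w, 0 <= X w) -> 0 <= Ex X.
Proof. by move=> X0; exact: Rintegral_ge0. Qed.

Lemma le_norm_Ex X : integrableR X -> `|Ex X| <= Ex (fun w => `|X w|).
Proof. exact: le_normr_Rintegral. Qed.

Lemma EFin_Ex X : integrableR X -> (Ex X)%:E = (\int[P]_w (X w)%:E)%E.
Proof. by move=> iX; rewrite /Ex /Rintegral fineK// integrable_fin_num. Qed.

Lemma measurable_ge X c : measurable_fun [set: T] X ->
  measurable [set w | c <= X w].
Proof.
move=> mX; rewrite -[X in measurable X]setTI.
rewrite (_ : [set w | _] = X @^-1` `[c, +oo[); last first.
  by apply/seteqP; split => w /=; rewrite in_itv/= andbT.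
by apply: mX => //; exact: measurable_itv.
Qed.

Lemma markov_Ex X c : 0 < c -> integrableR X -> (forall w, 0 <= X w) ->
  (P [set w | (c <= X w)%R] <= (Ex X / c)%:E)%E.
Proof.
move=> c0 iX X0; have mX := integrableR_measurable iX.
have := @le_integral_comp_abse _ _ _ P _ measurableT (EFin \o X) c id
  (@measurable_id _ _ _) (fun _ r0 => r0) (fun _ _ _ _ xy => xy).
move=> /(_ (proj2 (measurable_EFinP _ _) mX) c0)/=.
rewrite setTI.
have -> : [set x | (c%:E <= `|(X x)%:E|)%E] = [set w | c <= X w].
  by apply/seteqP; split => w /=; rewrite lee_fin ger0_norm.
have -> : (\int[P]_x `|(X x)%:E| = (Ex X)%:E)%E.
  by rewrite EFin_Ex//; apply: eq_integral => w _; rewrite /= ger0_norm.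
by move=> H; rewrite mulrC EFinM lee_pdivlMl// muleC.
Qed.

End Expectation.

Section IID.
Context {dT dZ} {T : measurableType dT} {ZT : measurableType dZ} {R : realType}.
Context {P : probability T R}.
Variables (Z : {RV P >-> ZT}) (Zs : nat -> {RV P >-> ZT}).
Hypothesis Zs_iid : iid_copies Z Zs.
Implicit Types g h : ZT -> R.

Lemma eq_distribution_integrable (X Y : {RV P >-> ZT}) g :
  (forall A, measurable A -> distribution P X A = distribution P Y A) ->
  measurable_fun [set: ZT] g ->
  integrableR P (g \o X) -> integrableR P (g \o Y) /\ Ex P (g \o X) = Ex P (g \o Y).
Proof.
move=> XY mg iX.
have mE : measurable_fun [set: ZT] (EFin \o g) by exact/measurable_EFinP.
have iY : integrableR P (g \o Y).
  apply/integrableP; split; first by apply/measurable_EFinP; exact: measurableT_comp.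
  have /integrableP[_] := iX; congr (_ < _)%E.
  have mabs : measurable_fun [set: ZT] (abse \o (EFin \o g)) by exact: measurableT_comp.
  have abs0 y : (0 <= (abse \o (EFin \o g)) y)%E by exact: abse_ge0.
  rewrite -(@ge0_integral_distribution _ _ _ _ _ P X (abse \o (EFin \o g)))//.
  rewrite -(@ge0_integral_distribution _ _ _ _ _ P Y (abse \o (EFin \o g)))//.
  by apply: eq_measure_integral => A mA _; exact: XY.
split => //; rewrite /Ex /Rintegral; congr fine.
rewrite -(@integral_distribution _ _ _ _ _ P X (EFin \o g))//.
rewrite -(@integral_distribution _ _ _ _ _ P Y (EFin \o g))//.
by apply: eq_measure_integral => A mA _; exact: XY.
Qed.

Lemma iid_integrable g i : measurable_fun [set: ZT] g ->
  integrableR P (g \o Z) -> integrableR P (g \o Zs i).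
Proof.
move=> mg iZ; apply: (proj1 (eq_distribution_integrable _ mg iZ)) => A mA.
by rewrite Zs_iid.2.
Qed.

Lemma iid_Ex g i : measurable_fun [set: ZT] g ->
  integrableR P (g \o Z) -> Ex P (g \o Zs i) = Ex P (g \o Z).
Proof.
move=> mg iZ; apply/esym/(proj2 (eq_distribution_integrable _ mg iZ)) => A mA.
by rewrite Zs_iid.2.
Qed.

Lemma iid_null (A : set ZT) i : measurable A -> P (Z @^-1` A) = 0%E ->
  P (Zs i @^-1` A) = 0%E.
Proof.
move=> mA PA; transitivity (distribution P (Zs i) A) => //.
by rewrite Zs_iid.2.
Qed.

Lemma independent_pair i j A B : i != j -> measurable A -> measurable B ->
  P (Zs i @^-1` A `&` Zs j @^-1` B) = (P (Zs i @^-1` A) * P (Zs j @^-1` B))%E.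
Proof.
move=> ij mA mB.
have := Zs_iid.1 [fset i; j]%fset (fun k => if k == i then A else B).
have ji : (j == i) = false by rewrite eq_sym (negPf ij).
rewrite big_fsetU1 ?inE//= big_seq_fset1 eqxx ji => <-; last by move=> k; case: ifP.
congr (P _); apply/seteqP; split => [w [wA wB] k /=|w H].
  rewrite !inE => /orP[/eqP ->|/eqP ->]; first by rewrite eqxx.
  by rewrite ji.
split; first by have := H i; rewrite /= eqxx !inE eqxx; exact.
by have := H j; rewrite /= ji !inE eqxx orbT; exact.
Qed.

(** The joint law of two distinct observations is the product of their laws, since
    it agrees with it on rectangles. *)
Lemma independent_Ex i j h h' (c : R) : i != j ->
  measurable_fun [set: ZT] h -> measurable_fun [set: ZT] h' ->
  (forall z, `|h z| <= c) -> (forall z, `|h' z| <= c) ->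
  Ex P (fun w => h (Zs i w) * h' (Zs j w)) = Ex P (h \o Zs i) * Ex P (h' \o Zs j).
Proof.
move=> ij mh mh' hc hc'.
have c0 z : 0 <= c := le_trans (normr_ge0 _) (hc z).
pose XY := (fun w => (Zs i w, Zs j w)) : T -> (ZT * ZT)%type.
have mXY : measurable_fun [set: T] XY by exact: measurable_fun_pair.
pose XYf : {mfun T >-> (ZT * ZT)%type} := HB.pack XY (isMeasurableFun.Build _ _ _ _ XY mXY).
pose mi : probability ZT R := distribution P (Zs i).
pose mj : probability ZT R := distribution P (Zs j).
pose H (z : ZT * ZT) := (h z.1 * h' z.2)%:E.
have mH : measurable_fun [set: ZT * ZT] (fun z : ZT * ZT => h z.1 * h' z.2).
  by apply: measurable_funM; [apply: measurableT_comp|apply: measurableT_comp].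
have Hc z : `|h z.1 * h' z.2| <= c * c by rewrite normrM ler_pM.
have iH : (mi \x mj)%E.-integrable [set: ZT * ZT] H.
  apply: (le_integrable _ _ _ (g := fun=> (c * c)%:E)) => //.
  - exact/measurable_EFinP.
  - by move=> z _; rewrite /= lee_fin (le_trans (Hc z))// ler_norm.
  - apply/integrableP; split => //.
    rewrite integral_cst//= -setXTT product_measure1E//= /mi /mj.
    by rewrite !probability_setT mule1 mule1 ltry.
have E1 : (\int[P]_w H (XY w) = \int[mi \x mj]_z H z)%E.
  rewrite -(@integral_distribution _ _ _ _ _ P XYf H)//; last 2 first.
  - exact/measurable_EFinP.
  - apply: (@integrableR_bounded _ _ _ P (fun w => h (Zs i w) * h' (Zs j w)) (c * c)).
      by apply: (measurableT_comp mH mXY).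
    by move=> w; exact: (Hc (XY w)).
  apply: eq_measure_integral => A mA _; apply/esym.
  apply: product_measure_unique => // A1 A2 mA1 mA2.
  exact: independent_pair.
have ih : integrableR mi h by exact: integrableR_bounded hc.
have ih' : integrableR mj h' by exact: integrableR_bounded hc'.
have -> : Ex P (h \o Zs i) = Ex mi h.
  rewrite /Ex /Rintegral; congr fine.
  rewrite -(@integral_distribution _ _ _ _ _ P (Zs i) (EFin \o h))//.
    exact/measurable_EFinP.
  apply: (@integrableR_bounded _ _ _ P (h \o Zs i) c) => [|w]; last exact: hc.
  exact: measurableT_comp.
have -> : Ex P (h' \o Zs j) = Ex mj h'.
  rewrite /Ex /Rintegral; congr fine.
  rewrite -(@integral_distribution _ _ _ _ _ P (Zs j) (EFin \o h'))//.
    exact/measurable_EFinP.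
  apply: (@integrableR_bounded _ _ _ P (h' \o Zs j) c) => [|w]; last exact: hc'.
  exact: measurableT_comp.
rewrite {1}/Ex /Rintegral; transitivity (fine (\int[P]_w H (XY w))%E) => //.
rewrite E1 -integral12_prod_meas1// /fubini_F.
transitivity (fine (\int[mi]_x ((h x)%:E * (Ex mj h')%:E))%E).
  congr fine; apply: eq_integral => x _; rewrite EFin_Ex// -integralZl//.
by rewrite integralZr// -EFin_Ex//.
Qed.

(** The off-diagonal terms of the square vanish, by independence and centring. *)
Lemma Ex_sqr_sum h (c : R) n : measurable_fun [set: ZT] h ->
  (forall z, `|h z| <= c) -> Ex P (h \o Z) = 0 ->
  Ex P (fun w => (\sum_(i < n) h (Zs i w)) ^+ 2) = n%:R * Ex P (fun w => h (Z w) ^+ 2).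
Proof.
move=> mh hc Eh0.
have c0 z : 0 <= c := le_trans (normr_ge0 _) (hc z).
have ihZ : integrableR P (h \o Z).
  by apply: (@integrableR_bounded _ _ _ P _ c) => [|w]; [exact: measurableT_comp|exact: hc].
have ihh i j : integrableR P (fun w => h (Zs i w) * h (Zs j w)).
  apply: (@integrableR_bounded _ _ _ P _ (c * c)) => [|w].
    by apply: measurable_funM; exact: measurableT_comp.
  by rewrite normrM ler_pM.
have -> : (fun w => (\sum_(i < n) h (Zs i w)) ^+ 2) =
    (fun w => \sum_(i < n) \sum_(j < n) h (Zs i w) * h (Zs j w)).
  apply/funext => w; rewrite expr2 mulr_suml; apply: eq_bigr => i _.
  by rewrite mulr_sumr.
rewrite Ex_sum; last by move=> i; exact: integrableR_sum.
have diag (i : 'I_n) : Ex P (fun w => \sum_(j < n) h (Zs i w) * h (Zs j w)) =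
    Ex P (fun w => h (Z w) ^+ 2).
  rewrite Ex_sum// (bigD1 i)//= big1 ?addr0 => [|j ji].
    have -> : (fun w => h (Zs i w) * h (Zs i w)) = (fun z => h z ^+ 2) \o Zs i.
      by apply/funext => w; rewrite /= expr2.
    rewrite iid_Ex//; first exact: measurable_funX.
    apply: (@integrableR_bounded _ _ _ P _ (c ^+ 2)) => [|w].
      by apply: measurableT_comp => //; exact: measurable_funX.
    by rewrite /= normrX lerXn2r ?nnegrE ?(c0 (Z w)) ?hc.
  by rewrite (independent_Ex _ mh mh hc hc) 1?eq_sym// iid_Ex// Eh0 mul0r.
by rewrite (eq_bigr _ (fun i _ => diag i)) sumr_const card_ord mulr_natl.
Qed.

Definition trunc (K x : R) : R := if `|x| <= K then x else 0.

Lemma measurable_trunc K : measurable_fun [set: R] (trunc K).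
Proof.
apply: measurable_fun_ifT => //.
by apply: measurable_fun_ler => //; exact: measurable_normr.
Qed.

Lemma norm_trunc_le K x : 0 <= K -> `|trunc K x| <= K.
Proof. by move=> K0; rewrite /trunc; case: ifP => //; rewrite normr0. Qed.

Lemma norm_trunc_tail K x : `|x - trunc K x| <= `|x|.
Proof. by rewrite /trunc; case: ifP; rewrite ?subrr ?normr0 ?subr0. Qed.

Definition Ex_tail g (K : R) : R := Ex P (fun w => `|g (Z w) - trunc K (g (Z w))|).

(** Chebyshev's inequality for the part of [g] below the level [K], and Markov's for
    the part above it. *)
Lemma mean_deviation g (K t : R) n : measurable_fun [set: ZT] g ->
  integrableR P (g \o Z) -> 0 <= K -> 0 < t -> (0 < n)%N ->
  (P [set w | (2 * t + Ex_tail g K <=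
       `|mean n g (fun i => Zs i w) - Ex P (g \o Z)|)%R] <=
   (Ex_tail g K / t + Ex P (fun w => trunc K (g (Z w)) ^+ 2) / (n%:R * t ^+ 2))%:E)%E.
Proof.
move=> mg ig K0 t0 n0; set tail := Ex_tail g K.
have n0' : 0 < n%:R :> R by rewrite ltr0n.
pose g1 z := trunc K (g z); pose g2 z := g z - g1 z.
have mg1 : measurable_fun [set: ZT] g1.
  exact: (measurableT_comp (measurable_trunc K) mg).
have mg2 : measurable_fun [set: ZT] g2 by exact: measurable_funB.
have g1K z : `|g1 z| <= K by exact: norm_trunc_le.
have ig1 : integrableR P (g1 \o Z).
  by apply: (@integrableR_bounded _ _ _ P _ K) => [|w]; [exact: measurableT_comp|exact: g1K].
have ig2 : integrableR P (g2 \o Z) by exact: integrableRB.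
pose e1 := Ex P (g1 \o Z).
pose h z := g1 z - e1.
have mh : measurable_fun [set: ZT] h by exact: measurable_funB.
have hK z : `|h z| <= K + `|e1| by apply: le_trans (ler_normB _ _) _; rewrite lerD2r.
have ih : integrableR P (h \o Z).
  by apply: (integrableRB ig1); exact: integrableR_cst.
have Eh : Ex P (h \o Z) = 0.
  by rewrite (ExB ig1 (integrableR_cst P e1)) Ex_cst subrr.
have K1 : 0 <= K + `|e1| by rewrite addr_ge0.
have mZ q i : measurable_fun [set: ZT] q -> measurable_fun [set: T] (fun w => q (Zs i w) : R).
  by move=> mq; exact: (measurableT_comp mq).
pose A w := \sum_(i < n) h (Zs i w).
pose B w := \sum_(i < n) `|g2 (Zs i w)|.
have mA : measurable_fun [set: T] A by apply: measurable_sum => i; exact: mZ.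
have iA2 : integrableR P (fun w => A w ^+ 2).
  apply: (@integrableR_bounded _ _ _ P _ ((n%:R * (K + `|e1|)) ^+ 2)) => [|w].
    exact: measurable_funX.
  rewrite normrX lerXn2r ?nnegrE ?mulr_ge0//.
  apply: le_trans (ler_norm_sum _ _ _) _.
  have -> : n%:R * (K + `|e1|) = \sum_(i < n) (K + `|e1|).
    by rewrite sumr_const card_ord mulr_natl.
  by apply: ler_sum => i _; exact: hK.
have i2 i : integrableR P (fun w => `|g2 (Zs i w)|).
  by apply: integrableR_norm; exact: (iid_integrable i mg2 ig2).
have iB : integrableR P B by exact: integrableR_sum.
have EB : Ex P B = n%:R * tail.
  rewrite Ex_sum// (eq_bigr (fun=> tail)) ?sumr_const ?card_ord ?mulr_natl// => i _.
  apply: (@iid_Ex (fun z => `|g2 z|) i); first exact: measurableT_comp.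
  exact: integrableR_norm.
have E2 : Ex P (fun w => h (Z w) ^+ 2) <= Ex P (fun w => g1 (Z w) ^+ 2).
  have i11 : integrableR P (fun w => g1 (Z w) ^+ 2).
    apply: (@integrableR_bounded _ _ _ P _ (K ^+ 2)) => [|w].
      by apply: measurable_funX; exact: measurableT_comp.
    by rewrite normrX lerXn2r ?nnegrE.
  have -> : (fun w => h (Z w) ^+ 2) =
      (fun w => (g1 (Z w) ^+ 2 - 2 * e1 * g1 (Z w)) + e1 ^+ 2).
    by apply/funext => w; rewrite /h; ring.
  have i12 : integrableR P (fun w => 2 * e1 * g1 (Z w)) by exact: integrableRZ.
  rewrite (ExD (integrableRB i11 i12) (integrableR_cst P _)) (ExB i11 i12).
  rewrite Ex_cst (ExZ _ ig1) -/e1.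
  by have := sqr_ge0 e1; rewrite !expr2; lra.
have tail0 : 0 <= tail by apply: Ex_ge0.
have nt0 : 0 < n%:R * t by rewrite mulr_gt0.
apply: (@le_trans _ _ (P ([set w | n%:R * t <= B w] `|`
    [set w | (n%:R * t) ^+ 2 <= A w ^+ 2]))).
  apply: le_measure; rewrite ?inE.
  - apply: measurable_ge; apply: measurableT_comp => //.
    apply: measurable_funB => //; apply: measurable_funM => //.
    by apply: measurable_sum => i; exact: mZ.
  - apply: measurableU; apply: measurable_ge; last exact: measurable_funX.
    exact: integrableR_measurable iB.
  - move=> w /= dev; apply: contrapT => /not_orP[/negP + /negP].
    rewrite -!ltNge => Bt At.
    have {}At : `|A w| < n%:R * t.
      rewrite -(@ltr_pXn2r _ 2)// ?nnegrE ?(ltW nt0)//.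
      by rewrite real_normK ?num_real.
    have E : mean n g (fun i => Zs i w) - Ex P (g \o Z) =
        n%:R^-1 * A w + n%:R^-1 * (\sum_(i < n) g2 (Zs i w)) - Ex P (g2 \o Z).
      rewrite /mean -mulrDr -big_split/=.
      have -> : Ex P (g \o Z) = Ex P (g2 \o Z) + e1.
        rewrite -(ExD ig2 ig1); congr (Ex P _).
        by apply/funext => w'; rewrite /= /g2 subrK.
      have -> : \sum_(i < n) (h (Zs i w) + g2 (Zs i w)) =
          \sum_(i < n) g (Zs i w) - n%:R * e1.
        rewrite mulr_natl -[n in _ *+ n]card_ord -sumr_const -sumrB.
        by apply: eq_bigr => i _; rewrite /h /g2; move: (g _) (g1 _) => *; ring.
      rewrite mulrBr mulKf ?gt_eqF//.
      by rewrite opprD addrA addrAC.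
    move: dev; rewrite E; apply/negP; rewrite -ltNge.
    apply: le_lt_trans (ler_normB _ _) _.
    apply: ltr_leD; last exact: le_norm_Ex.
    apply: le_lt_trans (ler_normD _ _) _.
    have -> : 2 * t = t + t by ring.
    rewrite !normrM gtr0_norm ?invr_gt0//.
    apply: ltrD; rewrite mulrC ltr_pdivrMr// mulrC//.
    exact: le_lt_trans (ler_norm_sum _ _ _) Bt.
apply: le_trans (measureU2 _ _ _) _.
- by apply: measurable_ge; exact: integrableR_measurable iB.
- by apply: measurable_ge; exact: measurable_funX.
rewrite EFinD; apply: leeD.
  apply: le_trans (markov_Ex nt0 iB _) _; first by move=> w; exact: sumr_ge0.
  by rewrite EB lee_fin -mulf_div divff ?gt_eqF// mul1r.
apply: le_trans (markov_Ex _ iA2 _) _; first by rewrite exprn_gt0.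
  by move=> w; exact: sqr_ge0.
rewrite (Ex_sqr_sum n mh hK Eh) lee_fin.
have -> : n%:R * Ex P (fun w => h (Z w) ^+ 2) / (n%:R * t) ^+ 2 =
    Ex P (fun w => h (Z w) ^+ 2) / (n%:R * t ^+ 2).
  by field; rewrite !gt_eqF.
by rewrite ler_wpM2r// invr_ge0 mulr_ge0 ?sqr_ge0// ltW.
Qed.

Lemma Ex_tail_small g (delta : R) : integrableR P (g \o Z) -> 0 < delta ->
  exists2 K : R, 0 <= K & Ex_tail g K <= delta.
Proof.
move=> ig d0; have mg := integrableR_measurable ig.
pose F (k : nat) w := `|g (Z w) - trunc k%:R (g (Z w))|.
have mF k : measurable_fun [set: T] (F k).
  apply: measurableT_comp => //; apply: measurable_funB => //.
  exact: (measurableT_comp (measurable_trunc k%:R) mg).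
have FG k w : `|F k w| <= `|g (Z w)| by rewrite normr_id; exact: norm_trunc_tail.
have iF k : integrableR P (F k).
  by apply: integrableR_le (mF k) (FG k) _; exact: integrableR_norm.
have F0 w : EFin \o F ^~ w @ \oo --> 0%E.
  have [k gk] : exists k : nat, `|g (Z w)| <= k%:R.
    by exists (Num.trunc `|g (Z w)|).+1; rewrite ltW// truncnS_gt.
  apply: cvg_near_cst; exists k => // j /= kj.
  rewrite /F /trunc ifT ?subrr ?normr0//.
  by apply: le_trans gk _; rewrite ler_nat.
have [_ _] := @dominated_convergence _ _ _ P _ measurableT (fun k => EFin \o F k)
  (cst 0%E) (fun w => `|g (Z w)|%:E) (fun k => (proj2 (measurable_EFinP _ _) (mF k)))
  (@measurable_cst _ _ _ _ _ _) (aeW _ (fun w _ => F0 w)) (integrableR_norm ig)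
  (aeW _ (fun w k _ => FG k w)).
rewrite integral0 => /fine_cvgP[_ /cvgrPdist_lt /(_ _ d0)] [k _ /(_ _ (leqnn k))].
rewrite sub0r normrN => /ltW H; exists k%:R => //.
by apply: le_trans H; exact: ler_norm.
Qed.

(** The exceptional event is explicit because [Q] need not be measurable. *)
Definition up_to_prob (eps : R) (Q : T -> Prop) := exists E : set T,
  [/\ measurable E, (P E <= eps%:E)%E & forall w, ~ E w -> Q w].

(** With probability tending to one. *)
Definition whp (Q : nat -> T -> Prop) := forall eps : R, 0 < eps ->
  exists N, forall n, (N <= n)%N -> up_to_prob eps (Q n).

Lemma up_to_prob_imply eps (Q Q' : T -> Prop) :
  (forall w, Q w -> Q' w) -> up_to_prob eps Q -> up_to_prob eps Q'.
Proof. by move=> QQ' [E [mE PE QE]]; exists E; split => // w /QE; exact: QQ'. Qed.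

Lemma up_to_prob_and eps eps' (Q Q' : T -> Prop) :
  up_to_prob eps Q -> up_to_prob eps' Q' ->
  up_to_prob (eps + eps') (fun w => Q w /\ Q' w).
Proof.
move=> [E [mE PE QE]] [E' [mE' PE' QE']]; exists (E `|` E'); split.
- exact: measurableU.
- by rewrite EFinD; apply: le_trans (measureU2 _ _ _) _ => //; exact: leeD.
- by move=> w /not_orP[/QE ? /QE'].
Qed.

Lemma up_to_prob_forall (I : finType) eps (Q : I -> T -> Prop) :
  (forall i, up_to_prob eps (Q i)) ->
  up_to_prob (#|I|%:R * eps) (fun w => forall i, Q i w).
Proof.
move=> HQ; have H : up_to_prob ((size (enum I))%:R * eps)
    (fun w => forall i, i \in enum I -> Q i w).
  elim: (enum I) => [|i s IHs].
    by exists set0; split => //; rewrite measure0 mul0r.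
  rewrite /= -natr1 mulrDl mul1r addrC.
  apply: up_to_prob_imply (up_to_prob_and (HQ i) IHs) => w [Qi Qs] j.
  by rewrite inE => /orP[/eqP->//|/Qs].
rewrite cardE; apply: up_to_prob_imply H => w Q0 i.
by apply: Q0; rewrite mem_enum.
Qed.

Lemma whp_imply (Q Q' : nat -> T -> Prop) :
  (forall n w, Q n w -> Q' n w) -> whp Q -> whp Q'.
Proof.
move=> QQ' hQ eps e0; have [N H] := hQ eps e0; exists N => n Nn.
by apply: up_to_prob_imply (H n Nn) => w; exact: QQ'.
Qed.

Lemma whp_and (Q Q' : nat -> T -> Prop) :
  whp Q -> whp Q' -> whp (fun n w => Q n w /\ Q' n w).
Proof.
move=> hQ hQ' eps e0; have e20 : 0 < eps / 2 by rewrite divr_gt0.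
have [N H] := hQ _ e20; have [N' H'] := hQ' _ e20.
exists (maxn N N') => n; rewrite geq_max => /andP[Nn N'n].
by rewrite (splitr eps); apply: up_to_prob_and; [exact: H|exact: H'].
Qed.

Lemma whp_true (Q : nat -> T -> Prop) : (forall n w, Q n w) -> whp Q.
Proof.
move=> HQ eps e0; exists 0 => n _; exists set0; split => //.
by rewrite measure0 lee_fin ltW.
Qed.

Lemma whp_forall (I : finType) (Q : I -> nat -> T -> Prop) :
  (forall i, whp (Q i)) -> whp (fun n w => forall i, Q i n w).
Proof.
move=> HQ; have H : whp (fun n w => forall i, i \in enum I -> Q i n w).
  elim: (enum I) => [|i s IHs]; first exact: whp_true.
  apply: whp_imply (whp_and (HQ i) IHs) => n w [Qi Qs] j.
  by rewrite inE => /orP[/eqP->//|/Qs].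
by apply: whp_imply H => n w Q0 i; apply: Q0; rewrite mem_enum.
Qed.

Lemma whp_ae (A : set ZT) : measurable A -> P (Z @^-1` A) = 0%E ->
  whp (fun n w => forall i, ~ A (Zs i w)).
Proof.
move=> mA A0 eps e0; exists 0 => n _.
have [N [mN N0 AN]] : P.-negligible (\bigcup_i Zs i @^-1` A).
  apply: negligible_bigcup => i; exists (Zs i @^-1` A); split => //.
    by rewrite -[X in measurable X]setTI; exact: measurable_funP.
  exact: iid_null.
exists N; split => //; first by rewrite N0 lee_fin ltW.
by move=> w nN i Ai; apply: nN; apply: AN; exists i.
Qed.

(** The truncation level is fixed first, to make the contribution of the tail small
    uniformly in [n]; Chebyshev's bound for the rest then vanishes as [n] grows. *)
Lemma weak_lln g (eta : R) : measurable_fun [set: ZT] g ->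
  integrableR P (g \o Z) -> 0 < eta ->
  whp (fun n w => `|mean n g (fun i => Zs i w) - Ex P (g \o Z)| < eta).
Proof.
move=> mg ig eta0 eps e0.
have t0 : 0 < eta / 4 by rewrite divr_gt0.
have d0 : 0 < Num.min (eta / 4) (eps / 2 * (eta / 4)).
  by rewrite lt_min t0 mulr_gt0// divr_gt0.
have [K K0] := Ex_tail_small ig d0; rewrite le_min => /andP[tail1 tail2].
set m2 := Ex P (fun w => trunc K (g (Z w)) ^+ 2).
have m20 : 0 <= m2 by apply: Ex_ge0 => w; exact: sqr_ge0.
have q0 : 0 < eps / 2 * (eta / 4) ^+ 2 by rewrite mulr_gt0 ?divr_gt0// exprn_gt0.
exists (Num.trunc (m2 / (eps / 2 * (eta / 4) ^+ 2))).+1 => n Nn.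
have n0 : (0 < n)%N by exact: leq_trans Nn.
have n0' : 0 < n%:R :> R by rewrite ltr0n.
exists [set w | 2 * (eta / 4) + Ex_tail g K <=
       `|mean n g (fun i => Zs i w) - Ex P (g \o Z)|]; split.
- apply: measurable_ge; apply: measurableT_comp => //.
  apply: measurable_funB => //; apply: measurable_funM => //.
  by apply: measurable_sum => i; exact: (measurableT_comp mg).
- apply: le_trans (mean_deviation mg ig K0 t0 n0) _.
  rewrite lee_fin (splitr eps) lerD//; first by rewrite ler_pdivrMr.
  rewrite -/m2 ler_pdivrMr ?mulr_gt0 ?exprn_gt0// mulrCA -ler_pdivrMr//.
  by apply/ltW/(lt_le_trans (truncnS_gt _)); rewrite ler_nat.
- move=> w /negP; rewrite -ltNge => /lt_le_trans; apply.
  by apply: le_trans (lerD (lexx _) tail1) _; lra.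
Qed.

(** Marcinkiewicz-Zygmund rate, in probability, from [1 + alpha] moments: truncate
    at [K = n ^ (1 / (1 + alpha))], the level at which both parts of
    [mean_deviation] have the order [K ^ (- alpha)] of the claim. *)
Lemma mean_rate g (alpha : R) : 0 < alpha <= 1 -> measurable_fun [set: ZT] g ->
  integrableR P (g \o Z) -> Ex P (g \o Z) = 0 ->
  integrableR P (fun w => `|g (Z w)| `^ (1 + alpha)) ->
  forall eps : R, 0 < eps -> exists2 M : R, 0 < M & forall n, (0 < n)%N ->
    up_to_prob eps (fun w =>
      `|mean n g (fun i => Zs i w)| <= M * n%:R `^ (- (alpha / (1 + alpha)))).
Proof.
move=> /andP[a0 a1] mg ig Eg0 ip eps e0.
set m := Ex P (fun w => `|g (Z w)| `^ (1 + alpha)).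
have m0 : 0 <= m by apply: Ex_ge0 => w; exact: powR_ge0.
(* Each part of the deviation has probability at most [m / M]. *)
pose M := 1 + 2 * m / eps.
have M1 : 1 <= M by rewrite lerDl divr_ge0 ?mulr_ge0// ltW.
have M0 : 0 < M by apply: lt_le_trans M1.
exists (2 * M + m); first by rewrite ltr_pwDl// mulr_gt0.
move=> n n0; have n0' : 0 < n%:R :> R by rewrite ltr0n.
pose K := n%:R `^ (1 + alpha)^-1.
have K0 : 0 < K by rewrite powR_gt0.
have a10 : 1 + alpha != 0 by rewrite gt_eqF// addr_gt0.
have Kn : K `^ (1 + alpha) = n%:R by rewrite -powRrM mulVf// powRr1// ltW.
pose r := K `^ (- alpha).
have r0 : 0 < r by rewrite powR_gt0.
have rE : n%:R `^ (- (alpha / (1 + alpha))) = r by rewrite /r -powRrM mulrN mulrC.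
have t0 : 0 < M * r by rewrite mulr_gt0.
have iT (q : R -> R) (c : R) : measurable_fun [set: R] q ->
    (forall x, 0 <= q x <= c * `|x| `^ (1 + alpha)) ->
    integrableR P (fun w => q (g (Z w))) /\ Ex P (fun w => q (g (Z w))) <= c * m.
  move=> mq qc; have iq : integrableR P (fun w => q (g (Z w))).
    apply: integrableR_le (integrableRZ c ip) => [|w].
      by apply: measurableT_comp => //; exact: measurableT_comp.
    by have /andP[q0 ?] := qc (g (Z w)); rewrite ger0_norm.
  split => //; rewrite /m -(ExZ c ip); apply: le_Ex => //.
    exact: integrableRZ.
  by move=> w; have /andP[] := qc (g (Z w)).
have [_ tail_le] : integrableR P (fun w => `|g (Z w) - trunc K (g (Z w))|) /\
    Ex_tail g K <= r * m.
  apply: (iT (fun x => `|x - trunc K x|)).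
    apply: measurableT_comp => //; apply: measurable_funB => //.
    exact: measurable_trunc.
  move=> x; rewrite normr_ge0/= /trunc; case: ifPn => [_|].
    by rewrite subrr normr0 mulr_ge0 ?powR_ge0.
  rewrite -ltNge => Kx; have x0 : 0 < `|x| by exact: lt_trans Kx.
  have -> : `|x| `^ (1 + alpha) = `|x| * `|x| `^ alpha.
    by rewrite powRD ?(gt_eqF x0) ?implybT// powRr1.
  rewrite subr0 /r powRN.
  rewrite ler_pdivlMl ?powR_gt0// mulrC ler_pM2l//.
  by rewrite ge0_ler_powR ?nnegrE ?ltW.
have [_ sq_le] : integrableR P (fun w => trunc K (g (Z w)) ^+ 2) /\
    Ex P (fun w => trunc K (g (Z w)) ^+ 2) <= K `^ (1 - alpha) * m.
  apply: (iT (fun x => trunc K x ^+ 2)).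
    by apply: measurable_funX; exact: measurable_trunc.
  move=> x; rewrite sqr_ge0/= /trunc; case: ifPn => [xK|_]; last first.
    by rewrite expr0n mulr_ge0 ?powR_ge0.
  have [->|x0] := eqVneq x 0; first by rewrite expr0n mulr_ge0 ?powR_ge0.
  have x0' : `|x| != 0 by rewrite normr_eq0.
  rewrite -real_normK ?num_real// -powR_mulrn//.
  rewrite (_ : 2%:R = (1 - alpha) + (1 + alpha)); last by ring.
  rewrite powRD ?x0' ?implybT// ler_wpM2r ?powR_ge0//.
  by apply: ge0_ler_powR => //; rewrite ?nnegrE ?subr_ge0// ltW.
exists [set w | 2 * (M * r) + Ex_tail g K <=
       `|mean n g (fun i => Zs i w) - Ex P (g \o Z)|]; split.
- apply: measurable_ge; apply: measurableT_comp => //.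
  apply: measurable_funB => //; apply: measurable_funM => //.
  by apply: measurable_sum => i; exact: (measurableT_comp mg).
- apply: le_trans (mean_deviation mg ig (ltW K0) t0 n0) _; rewrite lee_fin.
  have H1 : Ex_tail g K / (M * r) <= m / M.
    rewrite ler_pdivrMr//; apply: le_trans tail_le _.
    by rewrite mulrA divfK ?gt_eqF// mulrC.
  have H2 : Ex P (fun w => trunc K (g (Z w)) ^+ 2) / (n%:R * (M * r) ^+ 2) <= m / M.
    rewrite ler_pdivrMr ?mulr_gt0 ?exprn_gt0//; apply: le_trans sq_le _.
    have -> : m / M * (n%:R * (M * r) ^+ 2) = M * (n%:R * r ^+ 2 * m).
      by field; rewrite gt_eqF.
    have -> : n%:R * r ^+ 2 = K `^ (1 - alpha).
      rewrite -Kn /r expr2 -!powRD ?(gt_eqF K0) ?implybT//.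
      by congr (_ `^ _); ring.
    by rewrite ler_peMl// mulr_ge0 ?powR_ge0.
  apply: le_trans (lerD H1 H2) _.
  have -> : m / M + m / M = (2 * m) / M by field; rewrite gt_eqF.
  rewrite ler_pdivrMr//.
  have -> : eps * M = eps + 2 * m by rewrite /M; field; rewrite gt_eqF.
  by rewrite lerDr ltW.
- move=> w /negP; rewrite -ltNge Eg0 subr0 rE => /ltW/le_trans; apply.
  by rewrite (mulrDl (2 * M) m r) -mulrA lerD2l mulrC.
Qed.

End IID.

Arguments up_to_prob {dT T R} P eps Q.
Arguments whp {dT T R} P Q.

Section NullSets.
Context {dT} {T : measurableType dT} {R : realType} (P : probability T R).

Lemma Ex_null (N : set T) (X : T -> R) : measurable N -> P N = 0%E ->
  integrableR P X -> Ex P X = Rintegral P ([set: T] `\` N) X.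
Proof. by move=> mN PN iX; rewrite /Ex /Rintegral; congr fine; exact: negligible_integral. Qed.

Lemma le_Ex_null (N : set T) (X Y : T -> R) : measurable N -> P N = 0%E ->
  integrableR P X -> integrableR P Y -> (forall w, ~ N w -> X w <= Y w) ->
  Ex P X <= Ex P Y.
Proof.
move=> mN PN iX iY XY; rewrite !(Ex_null mN PN)//.
have mD : measurable ([set: T] `\` N) by exact: measurableD.
apply: le_Rintegral => //.
- exact: integrableS iX.
- exact: integrableS iY.
- by move=> w [_ /XY].
Qed.

Lemma integrableR_le_null (N : set T) (X Y : T -> R) : measurable N -> P N = 0%E ->
  measurable_fun [set: T] X -> integrableR P Y ->
  (forall w, ~ N w -> `|X w| <= Y w) -> integrableR P X.
Proof.
move=> mN PN mX iY XY.
have mX' : measurable_fun [set: T] (EFin \o X) by exact/measurable_EFinP.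
apply/(negligible_integrable mN measurableT mX' PN).
have mD : measurable ([set: T] `\` N) by exact: measurableD.
apply: (@le_integrable _ _ _ _ _ mD _ (EFin \o Y)).
- exact: measurable_funS mX'.
- by move=> w [_ /XY Xw]; rewrite /= lee_fin (le_trans Xw)// ler_norm.
- exact: integrableS iY.
Qed.

(** The dominating function may fail to be measurable: the integral of a nonnegative
    function is a supremum over the simple functions below it. *)
Lemma integrableR_expectation (X Y : T -> R) : measurable_fun [set: T] X ->
  (forall w, `|X w| <= Y w) -> ('E_P[Y] < +oo)%E -> integrableR P X.
Proof.
move=> mX XY; rewrite unlock => EY; apply/integrableP; split.
  exact/measurable_EFinP.
apply: le_lt_trans EY; rewrite !ge0_integralTE//.
- apply: le_ereal_sup => _ [h /= hX <-]; exists h => //= x.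
  by apply: le_trans (hX x) _; rewrite lee_fin.
- by move=> x; rewrite lee_fin (le_trans _ (XY x)).
Qed.

End NullSets.

(** * The population objective and the empirical Hessian *)

Section Arithmetic.
Context {R : realFieldType}.
Implicit Types a e f g h m n p q t v : R.

Lemma approximation_margin e1 e m t : 0 <= e1 * m -> 4 * (e1 * (1 + m)) = e ->
  0 < e1 -> 2 * e1 + m * (t + 2 * e1) <= m * t + e.
Proof. lra. Qed.

Lemma first_difference_le f f0 g h m n (D : R) t : n <= 1 -> 0 <= D -> 0 <= m ->
  f - f0 - t * g - t ^+ 2 * h / 2 <= D * (m * n) * (t * (t * 1)) / 2 ->
  f - f0 <= t * g + t ^+ 2 * ((`|h| + D * m) / 2).
Proof.
move=> n1 D0 m0; have t20 := sqr_ge0 t.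
have : t ^+ 2 * (D * (m * n)) <= t ^+ 2 * (D * m).
  by rewrite !ler_wpM2l// ler_piMr.
by have := ler_wpM2l t20 (ler_norm h); rewrite !expr2 !mulr1; lra.
Qed.

Lemma second_difference_le f1 f2 f0 p q v n m (D : R) t :
  f1 - f0 - t * p - t ^+ 2 * q / 2 <= D * (m * (t * n)) * (t * (t * v)) / 2 ->
  f2 - f0 + t * p - t ^+ 2 * q / 2 <= D * (m * (t * n)) * (t * (t * v)) / 2 ->
  (f1 - f0) + (f2 - f0) <= t ^+ 2 * q + t ^+ 3 * (D * n * v) * m.
Proof. by rewrite !exprS !expr0; lra. Qed.

Lemma midpoint_gap a f0 f1 f2 q v n (D E : R) t :
  f0 <= 2^-1 * f1 + (1 - 2^-1) * f2 - a / 2 * 2^-1 * (1 - 2^-1) * (2 * t * (2 * t * v)) ->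
  (f1 - f0) + (f2 - f0) <= t ^+ 2 * q + t ^+ 3 * (D * n * v) * E ->
  t ^+ 2 * (a * v) <= t ^+ 2 * (q + t * (D * n * v * E)).
Proof.
rewrite (_ : 1 - 2^-1 = 2^-1); last by field.
by rewrite !exprS !expr0; lra.
Qed.

Lemma descent_direction (D C t : R) : 0 < t * D ^+ 2 -> t * C < 1 ->
  0 <= - (t * D) * D + (t * D) ^+ 2 * C -> D = 0.
Proof.
move=> D20 tC; have : 0 < t * D ^+ 2 * (1 - t * C) by rewrite mulr_gt0// subr_gt0.
by rewrite !expr2; lra.
Qed.

End Arithmetic.

Section Population.
Context {R : realType} {dOm} {Om : measurableType dOm} {P : probability Om R}.
Context {ZT : ptopologicalType} {d : nat}.
Variables (Z : {RV P >-> borel ZT}) (Zs : nat -> {RV P >-> borel ZT}).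
Hypothesis Zs_iid : iid_copies Z Zs.
Variable f : 'rV[R]_d -> ZT -> R.
Hypothesis f_measurable : measurable_fun
  [set: (borel 'rV[R]_d * borel ZT)%type] (fun p => f p.1 p.2).
Variable F : 'rV[R]_d -> R.
Hypothesis f_integrable : forall theta,
  P.-integrable [set: Om] (fun w => (f theta (Z w))%:E).
Hypothesis F_def : forall theta, ((F theta)%:E = 'E_P[fun w => f theta (Z w)])%E.
Variables (c : 'rV[R]_d) (alpha : R).
Hypothesis F_min : is_minimizer F c.
Hypothesis A1 : locally_strongly_convex F.
Hypothesis alpha01 : 0 < alpha <= 1.
Hypothesis A2 : regular_objective Z f c alpha.
Implicit Types x y h u : 'rV[R]_d.

Let grd x k : borel ZT -> R := fun z => gradient (f ^~ z) x 0 k.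
Let hss x k l : borel ZT -> R := fun z => hessian (f ^~ z) x k l.

Lemma objective_differentiable z x : differentiable (f ^~ z) x.
Proof. by have [/(_ z)[]] := A2. Qed.

Lemma objective_gradient_differentiable z x : differentiable (gradient (f ^~ z)) x.
Proof. by have [/(_ z)[]] := A2. Qed.

Lemma objective_hessian_continuous z k l : continuous (fun x => hessian (f ^~ z) x k l).
Proof.
have [/(_ z)[_ _ ch] _ _ _] := A2.
move=> x; apply: (@continuous_comp _ _ _ (hessian (f ^~ z)) (fun A : 'M[R]_d => A k l)).
  exact: ch.
exact: coord_continuous.
Qed.

Let df := objective_differentiable.
Let dG := objective_gradient_differentiable.

Lemma measurable_objective dT (T : measurableType dT) (X : T -> borel ZT) :
  measurable_fun [set: T] X -> measurable_at_points (fun x t => f x (X t)).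
Proof.
move=> mX th mth.
have mth' := measurable_vec_borel mth.
exact: (measurableT_comp f_measurable (measurable_fun_pair mth' mX)).
Qed.

Let measurable_f : @measurable_at_points _ (borel ZT) R d f.
Proof. exact: (@measurable_objective _ (borel ZT) id). Qed.

Lemma measurable_objective_value x : measurable_fun [set: borel ZT] (f x : borel ZT -> R).
Proof. exact: (measurable_f (measurable_vec_cst x)). Qed.

Lemma measurable_objective_gradient x k : measurable_fun [set: borel ZT] (grd x k).
Proof. exact: (measurable_gradient measurable_f df k (measurable_vec_cst x)). Qed.

Lemma measurable_objective_hessian x k l : measurable_fun [set: borel ZT] (hss x k l).
Proof. exact: (measurable_hessian measurable_f df dG k l (measurable_vec_cst x)). Qed.

Lemma objective_Ex x : Ex P (f x \o Z) = F x.
Proof. by rewrite /Ex /Rintegral; have := F_def x; rewrite unlock => <-. Qed.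

Lemma objective_integrable x : integrableR P (f x \o Z).
Proof. exact: f_integrable. Qed.

(** The almost sure Lipschitz bound on the Hessian concerns [Z]; to pass it on to the
    observations, which only share the law of [Z], the exceptional event must be of
    the form [Z \in A]. Continuity of the Hessian lets rational points decide, so
    that [A] is a countable union. *)
Lemma hessian_lipschitz (r : R) : exists (M : borel ZT -> R) (A : set (borel ZT)),
  [/\ measurable_fun [set: borel ZT] M, forall z, 0 <= M z, integrableR P (M \o Z),
      measurable A /\ P (Z @^-1` A) = 0%E &
      forall z, ~ A z -> forall x y k l, `|x - c| < r -> `|y - c| < r ->
        `|hss x k l z - hss y k l z| <= M z * `|x - y|].
Proof.
have [_ _ _ /(_ _ (@compact_ball_le _ _ c r))[M [mM M0 EM [N [mN N0 HN]]]]] := A2.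
(* The factor [d] passes from the Euclidean to the sup norm. *)
pose M' z := d%:R * M z.
have mM' : measurable_fun [set: borel ZT] M' by exact: measurable_funM.
have M'0 z : 0 <= M' z by rewrite mulr_ge0.
pose pt (q : 'rV[rat]_d) : 'rV[R]_d := map_mx ratr q.
pose bad (i : 'rV[rat]_d * 'rV[rat]_d * 'I_d * 'I_d) : set (borel ZT) :=
  let: (q, q', k, l) := i in
  if (`|pt q - c| < r) && (`|pt q' - c| < r)
  then [set z | M' z * `|pt q - pt q'| < `|hss (pt q) k l z - hss (pt q') k l z|]
  else set0.
pose A := \bigcup_i bad i.
have mA : measurable A.
  apply: countable_bigcupT_measurable => [|[[[q q'] k] l]]; first exact: countableP.
  rewrite /bad; case: ifP => // _.
  have mh : measurable_fun [set: borel ZT]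
      (fun z => `|hss (pt q) k l z - hss (pt q') k l z|).
    apply: measurableT_comp => //.
    by apply: measurable_funB; exact: measurable_objective_hessian.
  have mm : measurable_fun [set: borel ZT] (fun z => M' z * `|pt q - pt q'|).
    exact: measurable_funM.
  have mb := measurable_fun_ltr mm mh.
  rewrite -[X in measurable X]setTI.
  exact: (mb measurableT [set true]).
exists M', A; split => //.
- apply: integrableRZ; apply: (@integrableR_expectation _ _ _ P _ (M \o Z)) => //.
    exact: measurableT_comp.
  by move=> w; rewrite /= ger0_norm.
- split => //; apply/eqP; rewrite eq_le measure_ge0 andbT -N0.
  apply: le_measure; rewrite ?inE//.
    by rewrite -[X in measurable X]setTI; exact: measurable_funP.
  move=> w [[[[q q'] k] l] _]; rewrite /bad; case: ifP => // /andP[qr q'r] /= lt.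
  apply: HN => /= H; move: lt; apply/negP; rewrite -leNgt.
  have -> : hss (pt q) k l (Z w) - hss (pt q') k l (Z w) =
      (hessian (f ^~ (Z w)) (pt q) - hessian (f ^~ (Z w)) (pt q')) k l.
    by rewrite subr_entry.
  apply: le_trans (opnorm_entry _ _ _) _.
  apply: le_trans (H _ _ (ltW qr) (ltW q'r)) _.
  rewrite /M' (mulrC d%:R) -mulrA; apply: ler_wpM2l => //.
  exact: enorm_le_normr.
- move=> z nAz x y k l xr yr; apply/ler_addgt0Pr => e e0.
  pose e1 := e / (4 * (1 + M' z)).
  have e10 : 0 < e1 by rewrite divr_gt0// mulr_gt0// ltr_pwDl.
  have approx x0 : `|x0 - c| < r -> exists q, [/\ `|pt q - c| < r, `|x0 - pt q| < e1 &
      `|hss x0 k l z - hss (pt q) k l z| < e1].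
    move=> x0r.
    have /cvgrPdist_lt/(_ _ e10)/nbhs_ballP[t /= t0 Ht] := @objective_hessian_continuous z k l x0.
    have m0 : 0 < Num.min t (Num.min e1 (r - `|x0 - c|)).
      by rewrite !lt_min t0 e10 subr_gt0.
    have [q] := rat_point_near x0 m0; rewrite !lt_min => /and3P[qt qe qr].
    exists q; split => //; last by apply: Ht; rewrite -ball_normE.
    rewrite -(subrKA x0); apply: le_lt_trans (ler_normD _ _) _.
    by rewrite -ltrBrDr distrC.
  have [q [qr xq hq]] := approx _ xr; have [q' [q'r yq' hq']] := approx _ yr.
  have key : `|hss (pt q) k l z - hss (pt q') k l z| <= M' z * `|pt q - pt q'|.
    rewrite leNgt; apply/negP => lt; apply: nAz.
    by exists (q, q', k, l) => //; rewrite /bad qr q'r.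
  have D1 : `|pt q - pt q'| <= `|x - y| + 2 * e1.
    have -> : pt q - pt q' = (x - y) + ((pt q - x) + (y - pt q')).
      by apply/rowP => i; rewrite !mxE; ring.
    apply: le_trans (ler_normD _ _) _; rewrite lerD2l.
    apply: le_trans (ler_normD _ _) _; rewrite distrC in xq.
    by rewrite mulrDl mul1r lerD// ltW.
  have D2 : `|hss x k l z - hss y k l z| <=
      2 * e1 + `|hss (pt q) k l z - hss (pt q') k l z|.
    move: hq hq'; move: (hss x k l z) (hss y k l z) => a1 a2.
    move: (hss (pt q) k l z) (hss (pt q') k l z) => b1 b2 hq hq'.
    have -> : a1 - a2 = ((a1 - b1) + (b2 - a2)) + (b1 - b2) by ring.
    apply: le_trans (ler_normD _ _) _; rewrite lerD2r.
    apply: le_trans (ler_normD _ _) _; rewrite distrC in hq'.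
    by rewrite mulrDl mul1r lerD// ltW.
  apply: (le_trans D2); apply: le_trans (lerD (lexx _) key) _.
  apply: le_trans (lerD (lexx _) (ler_wpM2l (M'0 z) D1)) _.
  have : 4 * (e1 * (1 + M' z)) = e.
    by rewrite /e1; field; rewrite gt_eqF// ltr_pwDl.
  have m0 := mulr_ge0 (ltW e10) (M'0 z).
  by move=> e1E; exact: approximation_margin m0 e1E e10.
Qed.

Lemma hessian_star_integrable k l : integrableR P (hss c k l \o Z).
Proof.
have [_ EH _ _] := A2; apply: integrableR_expectation EH => [|w].
  exact: (measurableT_comp (measurable_objective_hessian c k l)).
exact: opnorm_entry.
Qed.

Lemma gradient_star_power_integrable k :
  integrableR P (fun w => `|grd c k (Z w)| `^ (1 + alpha)).
Proof.
have /andP[a0 _] := alpha01.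
have [_ _ EG _] := A2; apply: integrableR_expectation EG => [|w].
  apply: (measurableT_comp (measurable_powR _)); apply: measurableT_comp => //.
  exact: (measurableT_comp (measurable_objective_gradient c k)).
rewrite ger0_norm ?powR_ge0// ge0_ler_powR ?nnegrE ?enorm_ge0 ?coord_le_enorm//.
by rewrite addr_ge0// ltW.
Qed.

(** A function with [1 + alpha] moments is integrable, as [x <= 1 + x ^ (1 + alpha)]. *)
Lemma gradient_star_integrable k : integrableR P (grd c k \o Z).
Proof.
have /andP[a0 _] := alpha01.
have i1 := integrableRD (integrableR_cst P 1) (gradient_star_power_integrable k).
apply: integrableR_le i1 => [|w].
  exact: (measurableT_comp (measurable_objective_gradient c k)).
rewrite /=; have [g1|g1] := leP `|grd c k (Z w)| 1.
  by apply: le_trans g1 _; rewrite lerDl powR_ge0.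
apply: (@le_trans _ _ (`|grd c k (Z w)| `^ (1 + alpha))); last by rewrite lerDr.
by apply: le1r_powR; [exact: ltW|rewrite lerDl ltW].
Qed.

Lemma taylor2_remainder (M : borel ZT -> R) r z x h :
  (forall x y k l, `|x - c| < r -> `|y - c| < r ->
    `|hss x k l z - hss y k l z| <= M z * `|x - y|) -> 0 <= M z ->
  `|x - c| < r -> `|x + h - c| < r ->
  `|f (x + h) z - f x z - dot (gradient (f ^~ z) x) h -
    quad (hessian (f ^~ z) x) h / 2| <= d%:R * (M z * `|h|) * dot h h / 2.
Proof.
move=> HM M0 xr yr.
have [s s01 E] := taylor2 x h (df z) (dG z).
rewrite (quad_remainder (hessian (f ^~ z) x) E).
rewrite normrM (ger0_norm (_ : 0 <= 2^-1))//.
rewrite ler_wpM2r//; apply: quad_bound => [|k l]; first by rewrite mulr_ge0.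
have zr : `|x + s *: h - c| < r.
  have rm : Num.max `|x - c| `|x + h - c| < r by rewrite gt_max xr.
  apply: le_lt_trans rm; have := @ball_convex _ _ c (Num.max `|x - c| `|x + h - c|) x (x + h) s s01.
  by rewrite (addrC x h) addrK (addrC h x); apply; rewrite le_max lexx ?orbT.
have := HM _ _ k l zr xr; rewrite subr_entry => /le_trans; apply; apply: ler_wpM2l => //.
case/andP: s01 => s0 s1.
by rewrite addrC addKr normrZ ger0_norm// ler_piMl.
Qed.

Lemma hessian_integrable x k l : integrableR P (hss x k l \o Z).
Proof.
have r0 : 0 < `|x - c| + 1 by rewrite ltr_pwDr.
have [M [A [mM M0 iM [mA A0] HM]]] := hessian_lipschitz (`|x - c| + 1).
have mN : measurable (Z @^-1` A).
  by rewrite -[X in measurable X]setTI; exact: measurable_funP.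
apply: (integrableR_le_null (N := Z @^-1` A) (Y := fun w =>
  `|hss c k l (Z w)| + `|x - c| * M (Z w))) => //.
- exact: (measurableT_comp (measurable_objective_hessian x k l)).
- apply: integrableRD; first by apply: integrableR_norm; exact: hessian_star_integrable.
  exact: integrableRZ.
- move=> w nA; rewrite /= -(subrK (hss c k l (Z w)) (hss x k l (Z w))) addrC.
  apply: le_trans (ler_normD _ _) _; rewrite lerD2l mulrC.
  by apply: HM => //; rewrite ?subrr ?normr0// ltrDl.
Qed.

Definition mean_hessian x : 'M[R]_d := \matrix_(k, l) Ex P (hss x k l \o Z).

Lemma quad_mean_hessian x u :
  integrableR P (fun w => quad (hessian (f ^~ (Z w)) x) u) /\
  Ex P (fun w => quad (hessian (f ^~ (Z w)) x) u) = quad (mean_hessian x) u.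
Proof.
have i1 k l : integrableR P (fun w => u 0 k * u 0 l * hss x k l (Z w)).
  by apply: integrableRZ; exact: hessian_integrable.
have i2 l : integrableR P (fun w => \sum_(k < d) u 0 k * u 0 l * hss x k l (Z w)).
  exact: integrableR_sum.
rewrite (_ : (fun w => _) =
    (fun w => \sum_(l < d) \sum_(k < d) u 0 k * u 0 l * hss x k l (Z w))); last first.
  apply/funext => w; rewrite quadE; apply: eq_bigr => l _.
  by apply: eq_bigr => k _; rewrite mulrAC.
split; first exact: integrableR_sum.
rewrite Ex_sum// quadE; apply: eq_bigr => l _; rewrite Ex_sum//.
apply: eq_bigr => k _; rewrite (ExZ _ (hessian_integrable x k l)) mxE.
by rewrite mulrAC.
Qed.

(** First order optimality. The second order expansion of [f] integrates to
    [0 <= F (c + t e) - F c <= t D + t^2 C] with [D] the expectation at stake, for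
    small [t] of either sign; this replaces differentiation under the expectation. *)
Lemma Ex_gradient_star k : Ex P (grd c k \o Z) = 0.
Proof.
have [M [A [mM M0 iM [mA A0] HM]]] := hessian_lipschitz 2.
have mN : measurable (Z @^-1` A).
  by rewrite -[X in measurable X]setTI; exact: measurable_funP.
pose e : 'rV[R]_d := delta_mx 0 k.
have ee : dot e e = 1 by rewrite dot_deltal mxE !eqxx.
have e1 : `|e| <= 1.
  by apply: normr_le_coord => // j; rewrite mxE eqxx/=; case: eqP; rewrite ?normr1 ?normr0.
pose U w := (`|hss c k k (Z w)| + d%:R * M (Z w)) / 2.
have iU : integrableR P U.
  rewrite (_ : U = (fun w => 2^-1 * (`|hss c k k (Z w)| + d%:R * M (Z w)))); last first.
    by apply/funext => w; rewrite mulrC.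
  apply: integrableRZ; apply: integrableRD.
    by apply: integrableR_norm; exact: hessian_star_integrable.
  exact: integrableRZ.
set C := Ex P U; set D := Ex P (grd c k \o Z).
have C0 : 0 <= C by apply: Ex_ge0 => w; rewrite divr_ge0 ?addr_ge0 ?mulr_ge0.
have key t : `|t| <= 1 -> 0 <= t * D + t ^+ 2 * C.
  move=> t1.
  have iB : integrableR P (fun w => t * grd c k (Z w) + t ^+ 2 * U w).
    by apply: integrableRD; apply: integrableRZ => //; exact: gradient_star_integrable.
  have iF : integrableR P (fun w => f (c + t *: e) (Z w) - f c (Z w)).
    by apply: integrableRB; exact: objective_integrable.
  have -> : t * D + t ^+ 2 * C = Ex P (fun w => t * grd c k (Z w) + t ^+ 2 * U w).
    rewrite ExD ?ExZ//; first exact: gradient_star_integrable.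
    - by apply: integrableRZ; exact: gradient_star_integrable.
    - exact: integrableRZ.
  apply: (@le_trans _ _ (F (c + t *: e) - F c)); first by rewrite subr_ge0.
  rewrite -!objective_Ex -ExB; try exact: objective_integrable.
  apply: (le_Ex_null mN A0 iF iB) => w nA.
  have c2 : `|c - c| < 2 by rewrite subrr normr0.
  have te : `|t *: e| <= `|t| by rewrite normrZ ler_piMr.
  have ct2 : `|c + t *: e - c| < 2.
    by rewrite addrC addKr; apply: le_lt_trans te _; apply: le_lt_trans t1 _; rewrite ltr1n.
  have := taylor2_remainder (HM _ nA) (M0 _) c2 ct2.
  rewrite ler_norml => /andP[_]; rewrite dotZl !dotZr ee quadZ.
  have -> : dot (gradient (f ^~ (Z w)) c) e = grd c k (Z w) by rewrite dotC dot_deltal.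
  have -> : quad (hessian (f ^~ (Z w)) c) e = hss c k k (Z w).
    by rewrite /quad -rowE dotC dot_deltal mxE.
  apply: first_difference_le => //.
  exact: le_trans te t1.
(* Unless [D = 0], the bound [t D + t^2 C] is negative at [t = - s D]. *)
pose s := (1 + C + `|D|)^-1.
have q0 : 0 < 1 + C + `|D| by rewrite ltr_wpDr// ltr_pwDl.
have s0 : 0 < s by rewrite invr_gt0.
have s1 : s * (1 + C + `|D|) = 1 by rewrite mulVf// gt_eqF.
have : `|- (s * D)| <= 1.
  rewrite normrN normrM gtr0_norm// -s1 ler_wpM2l ?(ltW s0)//.
  by rewrite lerDr addr_ge0.
move=> /key; rewrite sqrrN.
have sC : s * C < 1 by rewrite -s1 ltr_pM2l// -subr_gt0; have := normr_ge0 D; lra.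
have [//|D0] := eqVneq D 0.
have D20 : 0 < s * D ^+ 2 by rewrite mulr_gt0// exprn_even_gt0.
by move/(descent_direction D20 sC).
Qed.

(** The midpoint inequality of strong convexity survives in the limit of small
    second differences, so the mean Hessian inherits the constant. *)
Lemma mean_hessian_ge (r : R) : 0 <= r -> exists2 a : R, 0 < a &
  forall x u, `|x - c| <= r -> a * dot u u <= quad (mean_hessian x) u.
Proof.
(* The radius leaves room for the points [x + t u] and [x - t u]. *)
move=> r0; have [a a0 Ha] := A1 (@compact_ball_le _ _ c (r + 1)).
have [M [A [mM M0 iM [mA A0] HM]]] := hessian_lipschitz (r + 2).
have mN : measurable (Z @^-1` A).
  by rewrite -[X in measurable X]setTI; exact: measurable_funP.
exists a => // x u xr.
have [iq Eq] := quad_mean_hessian x u.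
pose C := d%:R * `|u| * dot u u * Ex P (M \o Z).
have C0 : 0 <= C.
  by apply: mulr_ge0; [rewrite !mulr_ge0 ?dot_ge0|apply: Ex_ge0 => w; exact: M0].
have u1 : 0 < 1 + `|u| by rewrite ltr_pwDl.
have key t : 0 < t -> t <= (1 + `|u|)^-1 -> a * dot u u <= quad (mean_hessian x) u + t * C.
  move=> t0 t1.
  have tu : `|t *: u| <= 1.
    rewrite normrZ gtr0_norm//; apply: (@le_trans _ _ (t * (1 + `|u|))).
      by rewrite ler_wpM2l ?(ltW t0)// lerDr.
    by rewrite -ler_pdivlMr// div1r.
  have xp : `|x + t *: u - c| <= r + 1.
    by rewrite addrAC; apply: le_trans (ler_normD _ _) _; exact: lerD.
  have xm : `|x - t *: u - c| <= r + 1.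
    by rewrite addrAC; apply: le_trans (ler_normB _ _) _; exact: lerD.
  have half01 : 0 <= (2^-1 : R) <= 1 by rewrite invr_ge0 ler0n invf_le1 ?ler1n.
  have := Ha 2^-1 _ _ half01 xp xm.
  rewrite (_ : 2^-1 *: _ + _ = x); last first.
    by apply/rowP => j; rewrite !mxE; field.
  rewrite enorm_sqr (_ : x + t *: u - _ = (2 * t) *: u); last first.
    by apply/rowP => j; rewrite !mxE; ring.
  rewrite dotZl dotZr => mid.
  have i2 : integrableR P (fun w => (f (x + t *: u) (Z w) - f x (Z w)) +
      (f (x - t *: u) (Z w) - f x (Z w))).
    by apply: integrableRD; apply: integrableRB; exact: objective_integrable.
  have iMu : integrableR P (fun w => t ^+ 3 * (d%:R * `|u| * dot u u) * M (Z w)).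
    exact: integrableRZ.
  have iR : integrableR P (fun w => t ^+ 2 * quad (hessian (f ^~ (Z w)) x) u +
      t ^+ 3 * (d%:R * `|u| * dot u u) * M (Z w)).
    by apply: integrableRD => //; exact: integrableRZ.
  have : Ex P (fun w => (f (x + t *: u) (Z w) - f x (Z w)) +
      (f (x - t *: u) (Z w) - f x (Z w))) <=
    Ex P (fun w => t ^+ 2 * quad (hessian (f ^~ (Z w)) x) u +
      t ^+ 3 * (d%:R * `|u| * dot u u) * M (Z w)).
    apply: (le_Ex_null mN A0 i2 iR) => w nA.
    have xr2 : `|x - c| < r + 2 by apply: le_lt_trans xr _; rewrite ltrDl.
    have r12 : r + 1 < r + 2 by rewrite ltrD2l ltr1n.
    have := taylor2_remainder (HM _ nA) (M0 _) xr2 (le_lt_trans xp r12).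
    have := taylor2_remainder (HM _ nA) (M0 _) xr2 (le_lt_trans xm r12).
    rewrite !ler_norml => /andP[_ tm] /andP[_ tp].
    move: tp tm; rewrite quadN normrN !(dotNr, dotNl) !opprK !dotZl !dotZr !quadZ.
    by rewrite normrZ (gtr0_norm t0); exact: second_difference_le.
  have iD y : integrableR P (fun w => f y (Z w)) by exact: objective_integrable.
  have EF y : Ex P (fun w => f y (Z w)) = F y by exact: objective_Ex.
  rewrite ExD ?ExB ?EF//; try exact: integrableRB.
  rewrite ExD//; last exact: integrableRZ.
  rewrite (ExZ _ iq) Eq (ExZ _ iM) => up.
  have t20 : 0 < t ^+ 2 by rewrite exprn_gt0.
  by rewrite -(ler_pM2l t20); exact: midpoint_gap mid up.
apply/ler_addgt0Pr => e e0.
pose t := Num.min (1 + `|u|)^-1 (e / (1 + C)).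
have C1 : 0 < 1 + C by rewrite ltr_pwDl.
have t0 : 0 < t by rewrite lt_min invr_gt0 u1 divr_gt0.
have tle : t <= (1 + `|u|)^-1 by rewrite ge_min lexx.
apply: le_trans (key t t0 tle) _; rewrite lerD2l.
apply: (@le_trans _ _ (e / (1 + C) * (1 + C))); last by rewrite divfK// gt_eqF.
apply: ler_pM => //; first exact: ltW.
  by rewrite ge_min lexx orbT.
by rewrite lerDr.
Qed.

Let Fn n w := empirical_objective f (fun i => Zs i w) n.

(** A finite net of points controls the whole ball, because the empirical Hessian is
    Lipschitz there with the convergent constant [mean n M]. *)
Lemma empirical_hessian_whp (r : R) : 0 <= r -> exists a L : R,
  [/\ 0 < a <= 1, 0 <= L & whp P (fun n w =>
    hessian_ge (Fn n w) c r a /\ hessian_entries_le (Fn n w) c r L)].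
Proof.
move=> r0; have [a a0 Ha] := mean_hessian_ge r0.
have [M [A [mM M0 iM [mA A0] HM]]] := hessian_lipschitz (r + 1).
pose EM := Ex P (M \o Z).
have EM0 : 0 <= EM by apply: Ex_ge0 => w; exact: M0.
(* [eta] bounds the sampling error of the entries at the net points, and their
   variation from a point of the ball to the net, whose mesh is [e]; together they
   cost at most half of the curvature [a]. *)
pose eta := a / (4 * (d%:R + 1)).
have d1 : 0 < d%:R + 1 :> R by rewrite ltr_wpDl.
have eta0 : 0 < eta by rewrite divr_gt0// mulr_gt0.
pose e := eta / (EM + 1).
have EM1 : 0 < EM + 1 by rewrite ltr_wpDl.
have e0 : 0 < e by rewrite divr_gt0.
have [s Hs] := @finite_net _ _ c r e e0.
have ih x k l := hessian_integrable x k l.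
have mh x k l := measurable_objective_hessian x k l.
pose S := (seq_sub (c :: s) * 'I_d * 'I_d)%type.
have W1 := whp_forall (fun p : S => weak_lln Zs_iid (mh (ssval p.1.1) p.1.2 p.2)
  (ih (ssval p.1.1) p.1.2 p.2) eta0).
have W2 := weak_lln Zs_iid mM iM (@ltr01 R).
have W3 := whp_ae Zs_iid mA A0.
pose L := \sum_(k < d) \sum_(l < d) `|mean_hessian c k l| + eta + (EM + 1) * r.
have L0 : 0 <= L.
  apply: addr_ge0; last by apply: mulr_ge0 => //; exact: ltW.
  apply: addr_ge0; last exact: ltW.
  by apply: sumr_ge0 => k _; exact: sumr_ge0.
pose a' := Num.min 1 (a / 2).
have a'0 : 0 < a' by rewrite lt_min ltr01 divr_gt0.
exists a', L; split; [by rewrite a'0 ge_min lexx|exact: L0|].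
have W := whp_and W1 (whp_and W2 W3).
apply: whp_imply W => n w [G1 [G2 G3]].
set ts := fun i => Zs i w.
have mM1 : mean n M ts <= EM + 1.
  by move: G2; rewrite ltr_distl => /andP[_ /ltW].
have HE x k l : hessian (Fn n w) x k l = mean n (hss x k l) ts.
  exact: hessian_empirical_entry.
have lip x y k l : `|x - c| <= r -> `|y - c| <= r ->
    `|mean n (hss x k l) ts - mean n (hss y k l) ts| <= (EM + 1) * `|x - y|.
  move=> xr yr; apply: (@le_trans _ _ (mean n M ts * `|x - y|)); last by rewrite ler_wpM2r.
  apply: mean_lipschitz => i; apply: HM; first exact: G3.
    by apply: le_lt_trans xr _; rewrite ltrDl.
  by apply: le_lt_trans yr _; rewrite ltrDl.
have at_net y k l : y \in c :: s -> `|mean n (hss y k l) ts - mean_hessian y k l| < eta.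
  by move=> ys; have := G1 (SeqSub ys, k, l); rewrite /= mxE.
split.
- move=> x u xr; have [y [ys yr xy]] := Hs x xr.
  have entries k l : `|(hessian (Fn n w) x - mean_hessian y) k l| <= 2 * eta.
    rewrite subr_entry HE -(subrKA (mean n (hss y k l) ts)).
    apply: le_trans (ler_normD _ _) _; rewrite mulrDl mul1r; apply: lerD.
      apply: le_trans (lip _ _ _ _ xr yr) _.
      apply: (@le_trans _ _ ((EM + 1) * e)); first by rewrite ler_wpM2l// ltW.
      by rewrite /e mulrCA divff ?gt_eqF// mulr1.
    by apply: ltW; apply: at_net; rewrite inE ys orbT.
  have eta20 : 0 <= 2 * eta by rewrite mulr_ge0// ltW.
  have := quad_bound u eta20 entries.
  rewrite quadB ler_norml => /andP[lo _].
  have up := Ha y u yr; have u0 := dot_ge0 u.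
  have deta : d%:R * (2 * eta) <= a / 2.
    rewrite /eta (_ : a / 2 = (d%:R + 1) * (2 * (a / (4 * (d%:R + 1))))); last first.
      by field; rewrite gt_eqF.
    by rewrite ler_wpM2r// lerDl.
  have a'a : a' <= a / 2 by rewrite ge_min lexx orbT.
  have := ler_wpM2r u0 deta; have := ler_wpM2r u0 a'a.
  lra.
- move=> x k l xr; rewrite HE.
  have cr : `|c - c| <= r by rewrite subrr normr0.
  have cs : c \in c :: s by rewrite inE eqxx.
  rewrite -(subrK (mean n (hss c k l) ts) (mean n (hss x k l) ts)) addrC.
  apply: le_trans (ler_normD _ _) _; apply: lerD; last first.
    by apply: le_trans (lip _ _ _ _ xr cr) _; rewrite ler_wpM2l// ltW.
  rewrite -(subrK (mean_hessian c k l) (mean n (hss c k l) ts)) addrC.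
  apply: le_trans (ler_normD _ _) _; apply: lerD; last exact/ltW/at_net.
  rewrite (bigD1 k)//= (bigD1 l)//= -addrA lerDl addr_ge0 ?sumr_ge0// => j _.
  exact: sumr_ge0.
Qed.

Lemma empirical_gradientE n w k :
  gradient (Fn n w) c 0 k = mean n (grd c k) (fun i => Zs i w).
Proof. exact: gradient_empirical_entry. Qed.

Lemma empirical_gradient_whp (eta : R) : 0 < eta ->
  whp P (fun n w => forall k, `|gradient (Fn n w) c 0 k| < eta).
Proof.
move=> eta0.
have := whp_forall (fun k => weak_lln Zs_iid (measurable_objective_gradient c k)
  (gradient_star_integrable k) eta0).
apply: whp_imply => n w H k; have := H k.
by rewrite Ex_gradient_star subr0 -empirical_gradientE.
Qed.

Lemma empirical_gradient_rate (eps : R) : 0 < eps -> exists2 M : R, 0 < M &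
  forall n, (0 < n)%N -> up_to_prob P eps (fun w =>
    enorm (gradient (Fn n w) c) <= M * n%:R `^ (- (alpha / (1 + alpha)))).
Proof.
move=> e0; have d1 : 0 < d%:R + 1 :> R by rewrite ltr_wpDl.
have ed0 : 0 < eps / (d%:R + 1) by rewrite divr_gt0.
have /choice[M HM] : forall k, exists M : R, 0 < M /\ forall n, (0 < n)%N ->
    up_to_prob P (eps / (d%:R + 1)) (fun w => `|gradient (Fn n w) c 0 k| <=
        M * n%:R `^ (- (alpha / (1 + alpha)))).
  move=> k; have [M M0 H] := mean_rate Zs_iid alpha01
    (measurable_objective_gradient c k) (gradient_star_integrable k)
    (Ex_gradient_star k) (gradient_star_power_integrable k) ed0.
  exists M; split => // n n0; apply: up_to_prob_imply (H n n0) => w.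
  by rewrite -empirical_gradientE.
have M0 k : 0 <= M k by exact: ltW (HM k).1.
pose M' := 1 + d%:R * \sum_(k < d) M k.
have sM0 : 0 <= \sum_(k < d) M k by apply: sumr_ge0.
have M'0 : 0 < M' by rewrite ltr_pwDl// mulr_ge0.
exists M' => // n n0.
have := up_to_prob_forall (fun k => (HM k).2 n n0).
have le_eps : #|'I_d|%:R * (eps / (d%:R + 1)) <= eps.
  by rewrite card_ord mulrCA ler_piMr ?(ltW e0)// ler_pdivrMr// mul1r lerDl.
case=> E [mE PE HE]; exists E; split => //.
  by apply: le_trans PE _; rewrite lee_fin.
move=> w /HE gk; apply: le_trans (enorm_le_normr _) _.
apply: (@le_trans _ _ (d%:R * ((\sum_(k < d) M k) * n%:R `^ (- (alpha / (1 + alpha)))))).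
  rewrite ler_wpM2l//; apply: normr_le_coord => [|k].
    by rewrite mulr_ge0 ?powR_ge0.
  apply: le_trans (gk k) _; rewrite ler_wpM2r ?powR_ge0//.
  by rewrite (bigD1 k)//= lerDl sumr_ge0.
by rewrite mulrA ler_wpM2r ?powR_ge0// lerDr.
Qed.

Lemma empirical_value_whp x :
  whp P (fun n w => Fn n w x - Fn n w c <= `|F x - F c| + 1).
Proof.
have mv y := measurable_objective_value y.
have iv y := objective_integrable y.
have mg : measurable_fun [set: borel ZT] (fun z => f x z - f c z : R).
  exact: measurable_funB (mv x) (mv c).
have ig : integrableR P ((fun z => f x z - f c z) \o Z).
  exact: (integrableRB (iv x) (iv c)).
have := weak_lln Zs_iid mg ig (@ltr01 R).
rewrite (ExB (iv x) (iv c)) !objective_Ex; apply: whp_imply => n w.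
have -> : mean n (fun z => f x z - f c z) (fun i => Zs i w) = Fn n w x - Fn n w c.
  by rewrite /mean sumrB mulrBr.
rewrite ltr_distl => /andP[_ lt]; apply: le_trans (ltW lt) _.
by rewrite lerD2r ler_norm.
Qed.

(** The radii are chosen in this order: the curvature on the unit ball and the
    initial gap confine the iterates to the ball of radius [r1]; the gradient bound
    there gives the radius [r2] of a ball containing every trial point; only then
    are the curvature and smoothness on that larger ball fixed. *)
Lemma descent_whp (theta0 : 'rV[R]_d) (beta : R) (Cgrad Ceval : nat) :
  0 < beta < 1 -> (0 < Ceval)%N ->
  exists2 C : R, 0 <= C & whp P (fun n w => forall B, (0 < n)%N -> (0 < B)%N ->
    enorm (gd_iterate
      (gd_run (Fn n w) (n * Cgrad) (n * Ceval) 0 beta theta0 B) - c) ^+ 2 <=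
    C * (n%:R / B%:R + enorm (gradient (Fn n w) c) ^+ 2)).
Proof.
move=> /andP[b0 b1] Ce0.
have [a1 [L1 [/andP[a10 _] _ H1]]] := empirical_hessian_whp ler01.
pose D := `|F theta0 - F c| + 1.
have D0 : 0 <= D by rewrite addr_ge0.
pose r1 := 1 + `|theta0 - c| + 8 * D / a1.
have D80 : 0 <= 8 * D / a1 by rewrite divr_ge0 ?mulr_ge0// ltW.
have r11 : 1 <= r1 by rewrite /r1 -addrA lerDl addr_ge0.
have r10 : 0 <= r1 by apply: le_trans r11.
have [a2 [L2 [_ L20 H2]]] := empirical_hessian_whp r10.
pose r2 := r1 + (1 + d%:R * (r1 * L2)).
have dr0 : 0 <= d%:R * (r1 * L2) by apply: mulr_ge0 => //; exact: mulr_ge0.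
have r20 : 0 <= r2 by apply: addr_ge0 => //; exact: addr_ge0.
have [a [L [/andP[a0 ale1] L0 H3]]] := empirical_hessian_whp r20.
have [K HK] : exists K, beta ^+ K * (d%:R * L) <= 1.
  have dL0 : 0 < d%:R * L + 1 by rewrite ltr_wpDl ?mulr_ge0.
  have nb : `|beta| < 1 by rewrite gtr0_norm.
  have /cvgrPdist_lt/(_ (d%:R * L + 1)^-1) := cvg_expr nb.
  rewrite invr_gt0 => /(_ dL0)[K _ /(_ K (leqnn K))].
  rewrite sub0r normrN ger0_norm ?exprn_ge0 ?(ltW b0)// => bK.
  exists K; apply: (@le_trans _ _ ((d%:R * L + 1)^-1 * (d%:R * L + 1))).
    by rewrite ler_pM ?exprn_ge0 ?mulr_ge0 ?(ltW b0) ?(ltW bK)// lerDl.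
  by rewrite mulVf// gt_eqF.
have d1 : 0 < d%:R + 1 :> R by rewrite ltr_wpDl.
pose eta := Num.min 1 (a1 / (4 * (d%:R + 1))).
have eta0 : 0 < eta by rewrite lt_min ltr01 divr_gt0// mulr_gt0.
have H4 := empirical_gradient_whp eta0.
have H5 := empirical_value_whp theta0.
pose kappa := beta ^+ K * a.
have kappa0 : 0 < kappa by rewrite mulr_gt0// exprn_gt0.
pose w0 := (Cgrad + K.+1 * Ceval)%N.
have q0 : 0 <= 3 / kappa * D * w0%:R.
  by rewrite !mulr_ge0// invr_ge0 ltW.
exists (4 / a * (3 / kappa * D * w0%:R + a^-1)).
  by rewrite mulr_ge0 ?addr_ge0 ?divr_ge0 ?invr_ge0// ltW.
have H := whp_and H1 (whp_and H2 (whp_and H3 (whp_and H4 H5))).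
apply: whp_imply H => n w [[G1 _] [[_ G2] [[G3 G3'] [G4 G5]]]] B n0 B0.
set g := Fn n w in G1 G2 G3 G3' G4 G5 *.
have dg x : differentiable g x by exact: differentiable_empirical_objective.
have dgg x : differentiable (gradient g) x.
  exact: differentiable_gradient_empirical_objective.
have gc_eta : `|gradient g c| <= eta.
  by apply: normr_le_coord => [|k]; [exact: ltW|apply: ltW; exact: G4].
have gc : dot (gradient g c) (gradient g c) <= a1 ^+ 2 / 8.
  apply: le_trans (dot_le_normr_sqr _) _.
  have eta_le : (d%:R + 1) * eta <= a1 / 4.
    have -> : a1 / 4 = (d%:R + 1) * (a1 / (4 * (d%:R + 1))).
      by field; rewrite gt_eqF.
    by apply: ler_wpM2l; [exact: ltW|rewrite ge_min lexx orbT].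
  have le1 : d%:R * `|gradient g c| ^+ 2 <= ((d%:R + 1) * eta) ^+ 2.
    rewrite [leRHS]exprMn; apply: ler_pM => //.
      have d0 : 0 <= d%:R :> R by []; rewrite expr2; nra.
    by rewrite lerXn2r ?nnegrE// ltW.
  apply: le_trans le1 _; apply: (@le_trans _ _ ((a1 / 4) ^+ 2)).
    by rewrite lerXn2r ?nnegrE ?mulr_ge0 ?divr_ge0 ?(ltW eta0) ?(ltW d1) ?(ltW a10).
  by rewrite !expr2; have := sqr_ge0 a1; rewrite expr2; lra.
have grad_r1 x : `|x - c| <= r1 -> `|gradient g x| <= r2 - r1.
  move=> xr; apply: le_trans (gradient_le dgg r10 L20 G2 xr) _.
  rewrite /r2 (addrC r1) addrK lerD2r; apply: le_trans gc_eta _.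
  by rewrite ge_min lexx.
have D8 : 8 * D <= a1 * r1.
  rewrite -ler_pdivrMl// mulrC /r1.
  by rewrite lerDr addr_ge0.
have t0r1 : `|theta0 - c| <= r1.
  by rewrite /r1 addrAC lerDr addr_ge0.
have nCe0 : (0 < n * Ceval)%N by rewrite muln_gt0 n0.
have := @gd_run_dist R d g dg dgg c theta0 a1 a L r1 r2 D beta K
  (n * Cgrad) (n * Ceval) B a10 G1 gc r11 D8 D0 t0r1 G5 grad_r1 a0 ale1 G3 L0 G3'
  b0 b1 HK nCe0 B0.
move=> /le_trans; apply.
have -> : (n * Cgrad + K.+1 * (n * Ceval))%N = (n * w0)%N.
  by rewrite /w0 mulnDr mulnCA.
rewrite -/kappa enorm_sqr natrM -[leRHS]mulrA; apply: ler_wpM2l.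
  by rewrite divr_ge0// ltW.
set e2 := dot _ _; have e20 : 0 <= e2 by exact: dot_ge0.
have nB0 : 0 <= n%:R / B%:R :> R by rewrite divr_ge0.
have ai0 : 0 <= a^-1 by rewrite invr_ge0 ltW.
have -> : 3 / kappa * D * (n%:R * w0%:R / B%:R) = 3 / kappa * D * w0%:R * (n%:R / B%:R).
  by rewrite -!mulrA; congr (_ * (_ * (_ * _))); rewrite mulrCA.
move: (3 / kappa * D * w0%:R) (n%:R / B%:R) a^-1 q0 nB0 ai0 => p q ai p0 q0' ai0.
have := mulr_ge0 p0 e20; have := mulr_ge0 ai0 q0'.
by rewrite mulrDl !mulrDr; move: (p * e2) (ai * q) => *; lra.
Qed.

Lemma measurable_descent (theta0 : 'rV[R]_d) (beta : R) (cgrad ceval n B : nat) :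
  measurable_fun [set: Om] (fun w =>
    enorm (gd_iterate (gd_run (Fn n w) cgrad ceval 0 beta theta0 B) - c)).
Proof.
apply: measurable_enorm; apply: measurable_vecB; last exact: measurable_vec_cst.
apply: (@measurable_gd_run _ Om R d (fun x w => Fn n w x)) => [th mth|w x].
  apply: measurable_funM => //; apply: measurable_sum => i.
  exact: measurable_objective mth.
exact: differentiable_empirical_objective.
Qed.

End Population.

(** * Rates in probability *)

Section Rates.
Context {R : realType} {dOm} {Om : measurableType dOm} (P : probability Om R).

Lemma bigO_P_up_to_prob (X : nat -> Om -> R) (a : nat -> R) :
  (forall B, (0 < B)%N -> measurable_fun [set: Om] (X B)) ->
  (forall eps : R, 0 < eps < 1 -> exists (M : R) (N : nat), forall B, (N <= B)%N ->
    0 < a B /\ up_to_prob P eps (fun w => `|X B w| < M * a B)) ->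
  bigO_P P X a.
Proof.
move=> mX H; split => // eps eps01; have [M [N HN]] := H eps eps01; exists M.
pose u B := P [set w | (M <= `|X B w / a B|)%R].
suff uN : (esups u N.+1 <= eps%:E)%E.
  apply: le_trans uN; rewrite limn_esup_lim (cvg_lim _ (@cvg_esups_inf _ u))//.
  by apply: ereal_inf_lbound; exists N.+1.
apply: ge_ereal_sup => _ [B /= NB <-].
have [aB [E [mE PE HE]]] := HN B (ltnW NB).
have mXB : measurable_fun [set: Om] (X B) by apply: mX; exact: leq_trans NB.
apply: le_trans PE; apply: le_measure; rewrite ?inE//.
  apply: measurable_ge; apply: measurableT_comp => //.
  exact: measurable_funM.
move=> w /= MX; apply: contrapT => /HE; apply/negP; rewrite -leNgt.
by rewrite -ler_pdivlMr// -[a B]gtr0_norm// -normrV ?unitfE ?gt_eqF// -normrM.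
Qed.

Lemma limn_einf_gt0_near (u : nat -> R) : (0 < limn_einf (EFin \o u))%E ->
  exists2 c : R, 0 < c & exists N, forall k, (N <= k)%N -> c <= u k.
Proof.
rewrite limn_einf_lim (cvg_lim _ (@cvg_einfs_sup _ _))// => /ereal_sup_gt[_ [N _ <-]] i0.
have lb k : (N <= k)%N -> (einfs (EFin \o u) N <= (u k)%:E)%E.
  by move=> Nk; apply: ereal_inf_lbound; exists k.
have iN := lb N (leqnn N).
have fin : einfs (EFin \o u) N \is a fin_num.
  by rewrite fin_numElt (lt_trans _ i0) ?ltNyr//= (le_lt_trans iN) ?ltry.
exists (fine (einfs (EFin \o u) N)).
  by rewrite -lte_fin fineK.
by exists N => k /lb; rewrite -lee_fin fineK.
Qed.

Lemma limn_esup_lty_near (u : nat -> R) : (limn_esup (EFin \o u) < +oo)%E ->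
  exists2 c : R, 0 < c & exists N, forall k, (N <= k)%N -> u k <= c.
Proof.
rewrite limn_esup_lim (cvg_lim _ (@cvg_esups_inf _ _))// => /ereal_inf_lt[_ [N _ <-]] i0.
have ub k : (N <= k)%N -> ((u k)%:E <= esups (EFin \o u) N)%E.
  by move=> Nk; apply: ereal_sup_ubound; exists k.
have iN := ub N (leqnn N).
have fin : esups (EFin \o u) N \is a fin_num.
  by rewrite fin_numElt i0 andbT (lt_le_trans _ iN) ?ltNyr.
exists (Num.max 1 (fine (esups (EFin \o u) N))); first by rewrite lt_max ltr01.
exists N => k /ub; rewrite -[esups _ _]fineK// lee_fin => ukN.
by rewrite le_max ukN orbT.
Qed.

End Rates.

Section Exponents.
Context {R : realType}.
Variable alpha : R.
Hypothesis alpha_gt0 : 0 < alpha.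

Let gamma := (1 + alpha) / (1 + 3 * alpha).
Let p := alpha / (1 + alpha).
Let q := alpha / (1 + 3 * alpha).

Let a1 : 0 < 1 + alpha. Proof. by rewrite addr_gt0. Qed.
Let a3 : 0 < 1 + 3 * alpha. Proof. by rewrite addr_gt0// mulr_gt0. Qed.

(** The left side is the order of the optimization error after [B / m] steps, the
    right side that of the squared statistical error; [gamma] balances them because
    [gamma * (1 + 2 p) = 1]. *)
Lemma sample_budget_ratio (c B : R) (m : nat) : 0 < c -> 0 < B -> (0 < m)%N ->
  m%:R <= c * B `^ gamma ->
  m%:R / B <= c `^ (1 + 2 * p) * (m%:R `^ (- p)) ^+ 2.
Proof.
move=> c0 B0 m0 mB; have m0' : 0 < m%:R :> R by rewrite ltr0n.
have p0 : 0 < p by exact: divr_gt0.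
have p20 : 0 <= 1 + 2 * p by rewrite addr_ge0// mulr_ge0// ltW.
have := ge0_ler_powR p20 (ltW m0' : m%:R \in Num.nneg) _ mB.
rewrite nnegrE mulr_ge0 ?powR_ge0 ?(ltW c0)// => /(_ isT).
rewrite powRM ?powR_ge0 ?(ltW c0)// -powRrM.
have -> : gamma * (1 + 2 * p) = 1.
  by rewrite /gamma /p; field; rewrite !gt_eqF.
have -> : m%:R `^ (1 + 2 * p) = m%:R * m%:R `^ (2 * p) :> R.
  by rewrite powRD ?(gt_eqF m0') ?implybT// powRr1.
rewrite (powRr1 (ltW B0)) => H.
have -> : (m%:R `^ (- p)) ^+ 2 = (m%:R `^ (2 * p))^-1.
  by rewrite powRN exprVn -powR_mulrn ?powR_ge0// -powRrM mulrC.
rewrite ler_pdivrMr// mulrAC ler_pdivlMr ?powR_gt0//.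
Qed.

Lemma sample_rate_budget (c B : R) (m : nat) : 0 < c -> 0 < B ->
  c * B `^ gamma <= m%:R -> m%:R `^ (- p) <= c `^ (- p) * B `^ (- q).
Proof.
move=> c0 B0 mB; have cB0 : 0 < c * B `^ gamma by rewrite mulr_gt0 ?powR_gt0.
have -> : B `^ (- q) = (B `^ gamma) `^ (- p).
  rewrite -powRrM; congr (_ `^ _); rewrite /gamma /p /q; field.
  by rewrite !gt_eqF.
rewrite -powRM ?powR_ge0 ?(ltW c0)// !powRN lef_pV2 ?posrE ?powR_gt0//; last first.
  exact: lt_le_trans mB.
have p0 : 0 < p by exact: divr_gt0.
by apply: ge0_ler_powR => //; rewrite ?nnegrE ?ler0n// ltW.
Qed.

Lemma sample_size_unbounded (c : R) (N0 : nat) : 0 < c ->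
  exists B0, forall B m : nat, (B0 <= B)%N -> c * B%:R `^ gamma <= m%:R -> (N0 <= m)%N.
Proof.
move=> c0; pose t := (N0%:R / c) `^ gamma^-1 : R.
have g0 : 0 < gamma by rewrite divr_gt0.
exists (Num.trunc t).+1 => B m tB mB; rewrite -(ler_nat R); apply: le_trans mB.
have tB' : t <= B%:R.
  by apply/ltW/(lt_le_trans (truncnS_gt _)); rewrite ler_nat.
rewrite mulrC -ler_pdivrMr//.
have -> : N0%:R / c = t `^ gamma.
  rewrite /t -powRrM mulVf ?gt_eqF// powRr1// divr_ge0// ltW//.
by apply: ge0_ler_powR => //; rewrite ?nnegrE ?powR_ge0 ?ler0n// ltW.
Qed.

End Exponents.

Theorem corollary2 (R : realType) (dOm : measure_display)
    (Om : measurableType dOm) (P : probability Om R)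
    (P_complete : measure_is_complete P)
    (ZT : ptopologicalType) (ZT_polish : polish R ZT)
    (Z : {RV P >-> borel ZT}) (Zs : nat -> {RV P >-> borel ZT})
    (Zs_iid : iid_copies Z Zs)
    (d : nat) (d_ge1 : (1 <= d)%N)
    (f : 'rV[R]_d -> ZT -> R)
    (f_measurable : measurable_fun
       [set: (borel 'rV[R]_d * borel ZT)%type] (fun p => f p.1 p.2))
    (f_differentiable : forall theta z, differentiable (f ^~ z) theta)
    (F : 'rV[R]_d -> R)
    (f_integrable : forall theta,
       P.-integrable [set: Om] (fun w => (f theta (Z w))%:E))
    (F_def : forall theta, ((F theta)%:E = 'E_P[fun w => f theta (Z w)])%E)
    (F_strictly_convex : strictly_convex F)
    (thetastar : 'rV[R]_d) (F_min : is_minimizer F thetastar)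
    (Cgrad Ceval : nat) (Cgrad_gt0 : (0 < Cgrad)%N) (Ceval_gt0 : (0 < Ceval)%N)
    (A1 : locally_strongly_convex F)
    (alpha : R) (alpha01 : 0 < alpha <= 1)
    (A2 : regular_objective Z f thetastar alpha)
    (theta0 : 'rV[R]_d) (beta : R) (beta01 : 0 < beta < 1)
    (n : nat -> nat) (n_gt0 : forall B, (0 < B)%N -> (0 < n B)%N)
    (n_liminf : (0 < limn_einf (fun B =>
       ((n B)%:R / B%:R `^ ((1 + alpha) / (1 + 3 * alpha)))%:E))%E)
    (n_limsup : (limn_esup (fun B =>
       ((n B)%:R / B%:R `^ ((1 + alpha) / (1 + 3 * alpha)))%:E) < +oo)%E) :
  let thetatilde (B : nat) (w : Om) : 'rV[R]_d :=
    (GD f (fun i => Zs i w) Cgrad Ceval theta0 (n B) B 0 beta).1 in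
  bigO_P P (fun B w => enorm (thetatilde B w - thetastar))
    (fun B => (n B)%:R `^ (- (alpha / (1 + alpha)))) /\
  bigO_P P (fun B w => enorm (thetatilde B w - thetastar))
    (fun B => B%:R `^ (- (alpha / (1 + 3 * alpha)))).
Proof.
move=> thetatilde; have /andP[al0 al1] := alpha01.
pose gamma := (1 + alpha) / (1 + 3 * alpha); pose p := alpha / (1 + alpha).
have [c1 c10 [N1 HN1]] := limn_einf_gt0_near n_liminf.
have [c2 c20 [N2 HN2]] := limn_esup_lty_near n_limsup.
have [C C0 HC] := descent_whp Zs_iid f_measurable f_integrable F_def F_min A1
  alpha01 A2 theta0 Cgrad beta01 Ceval_gt0.
have mX B : (0 < B)%N ->
    measurable_fun [set: Om] (fun w => enorm (thetatilde B w - thetastar)).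
  by move=> _; exact: (measurable_descent Zs f_measurable A2).
(* The rate in [n] is the smaller one, up to a constant: a single event serves both
   conclusions. *)
have rate (eps : R) : 0 < eps < 1 -> exists (M : R) (N : nat), 0 < M /\
    forall B, (N <= B)%N -> 0 < (n B)%:R `^ (- p) :> R /\
      (n B)%:R `^ (- p) <= c1 `^ (- p) * B%:R `^ (- (alpha / (1 + 3 * alpha))) /\
      (0 < B)%N /\
      up_to_prob P eps (fun w =>
        `|enorm (thetatilde B w - thetastar)| < M * (n B)%:R `^ (- p)).
  move=> /andP[eps0 _]; have e20 : 0 < eps / 2 by rewrite divr_gt0.
  have [N3 HN3] := HC _ e20.
  have [M M0 HM] := empirical_gradient_rate Zs_iid f_measurable f_integrable F_def
    F_min alpha01 A2 e20.
  have [N4 HN4] := sample_size_unbounded al0 N3 c10.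
  pose M' := C * (c2 `^ (1 + 2 * p) + M ^+ 2).
  have M'0 : 0 <= M' by rewrite mulr_ge0// addr_ge0 ?powR_ge0 ?sqr_ge0.
  exists (1 + M'), (maxn 1 (maxn N1 (maxn N2 N4))); split.
    by rewrite ltr_pwDl.
  move=> B; rewrite !geq_max => /and4P[B0 BN1 BN2 BN4].
  have B0' : 0 < B%:R :> R by rewrite ltr0n.
  have nB0 := n_gt0 _ B0.
  have nB0' : 0 < (n B)%:R :> R by rewrite ltr0n.
  have Bg0 : 0 < B%:R `^ gamma by rewrite powR_gt0.
  have lo : c1 * B%:R `^ gamma <= (n B)%:R.
    by have := HN1 _ BN1; rewrite ler_pdivlMr.
  have hi : (n B)%:R <= c2 * B%:R `^ gamma.
    by have := HN2 _ BN2; rewrite ler_pdivrMr.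
  have rpos : 0 < (n B)%:R `^ (- p) :> R by rewrite powR_gt0.
  split => //; split; first exact: sample_rate_budget.
  split => //.
  rewrite (splitr eps).
  have := up_to_prob_and (HN3 _ (HN4 _ _ BN4 lo)) (HM _ nB0).
  apply: up_to_prob_imply => w [/(_ B nB0 B0) D1 D2].
  rewrite ger0_norm ?enorm_ge0//.
  have ratio := sample_budget_ratio al0 c20 B0' nB0 hi.
  have sq : enorm (thetatilde B w - thetastar) ^+ 2 <= M' * ((n B)%:R `^ (- p)) ^+ 2.
    apply: le_trans D1 _; rewrite /M' -mulrA ler_wpM2l// mulrDl; apply: lerD => //.
    rewrite -exprMn lerXn2r ?nnegrE ?enorm_ge0//.
    by rewrite mulr_ge0 ?ltW.
  rewrite -(@ltr_pXn2r _ 2)// ?nnegrE ?enorm_ge0//; last first.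
    by rewrite mulr_ge0 ?addr_ge0// ltW.
  apply: le_lt_trans sq _; rewrite exprMn ltr_pM2r ?exprn_gt0//.
  by rewrite expr2; nra.
split; apply: bigO_P_up_to_prob => // eps eps01; have [M [N [M0 HN]]] := rate eps eps01.
  exists M, N => B NB; have [rpos [_ [_ H]]] := HN B NB.
  by split.
exists (M * c1 `^ (- p)), N => B NB; have [rpos [le [B0 H]]] := HN B NB.
split; first by rewrite powR_gt0// ltr0n.
apply: up_to_prob_imply H => w /lt_le_trans; apply.
by rewrite -mulrA ler_wpM2l// ltW.
Qed.
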